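(* Let $p\ge2$ be an integer, $h>0$, and $0<\beta<\beta_p$, where $\beta_p>0$ is defined by $8p^2\beta_p^2\exp(16\beta_p^2p)=\frac12$. Let $q\in[0,1]$ be the (unique) solution of $q=\mathbf E\big[\tanh^2\big(\beta(\frac p2)^{1/2}q^{\frac{p-1}{2}}Y+h\big)\big]$, $Y$ a standard Gaussian random variable. Then there is a constant $K$, not depending on $N$, such that for all $N\ge p$ $$\big|\nu(R_{1,2}-q)\big|\le\frac KN .$$
   Context: $p$-spin model with external field. Let $\Sigma_N=\{-1,1\}^N$, $A_N^p=\{(i_1,\dots,i_p)\in\mathbb N^p:1\le i_1<\dots<i_p\le N\}$, $u_N=\big(\frac{p!}{2N^{p-1}}\big)^{1/2}$, and let $\{g_{i_1,\dots,i_p}:(i_1,\dots,i_p)\in A_N^p\}$ be independent standard Gaussian random variables (the disorder). The Hamiltonian is $$-H_{N,\beta,h}(\sigma)=\beta u_N\sum_{(i_1,\dots,i_p)\in A_N^p}g_{i_1,\dots,i_p}\sigma_{i_1}\cdots\sigma_{i_p}+h\sum_{i=1}^N\sigma_i,\quad \sigma\in\Sigma_N,$$ and $Z_N=\sum_{\sigma\in\Sigma_N}\exp(-H_{N,\beta,h}(\sigma))$. For $f:\Sigma_N^n\to\mathbb R$, $$\langle f\rangle=Z_N^{-n}\sum_{(\sigma^1,\dots,\sigma^n)\in\Sigma_N^n}f(\sigma^1,\dots,\sigma^n)\exp\Big(-\sum_{l\le n}H_{N,\beta,h}(\sigma^l)\Big),\qquad \nu(f)=\mathbf E\langle f\rangle,$$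 with $\mathbf E$ the expectation over the disorder. The overlap is $R_{1,2}=\frac1N\sum_{i=1}^N\sigma_i^1\sigma_i^2$. *)

(* Defs.v *)
From HB Require Import structures.
From mathcomp Require Import all_boot all_order all_algebra.
From mathcomp Require Import all_classical all_reals all_analysis.
Set Implicit Arguments.
Unset Strict Implicit.
Unset Printing Implicit Defensive.
Import Order.TTheory GRing.Theory Num.Theory.
Import numFieldNormedType.Exports.
Local Open Scope classical_set_scope.
Local Open Scope ring_scope.

Definition tanh {R : realType} (x : R) : R :=
  (expR x - expR (- x)) / (expR x + expR (- x)).

Section probability.
Context {R : realType} {d : measure_display} {T : measurableType d}.
Variable P : probability T R.

Definition standard_gaussian (X : {RV P >-> R}) : Prop :=
  forall B : set R, measurable B ->
    distribution P X B = normal_prob (0 : R) 1 B.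

Definition mutually_independent {I : finType} (X : I -> {RV P >-> R}) : Prop :=
  forall (J : {set I}) (B : I -> set R), (forall i, measurable (B i)) ->
    P (\bigcap_(i in [set` J]) (X i @^-1` B i)) =
    (\prod_(i in J) P (X i @^-1` B i))%E.

End probability.

(* The spin of a boolean is [(-1) ^+ b], so that [{-1, 1}^N] is encoded by
   [{ffun 'I_N -> bool}]. *)
Definition config (N : nat) := {ffun 'I_N -> bool}.

Definition spin {R : realType} {N : nat} (s : config N) (i : 'I_N) : R :=
  (-1) ^+ s i.

(* Strictly increasing p-tuples of sites; sites are numbered from 0. *)
Definition psites (N p : nat) :=
  {t : p.-tuple 'I_N | sorted ltn [seq val i | i <- t]}.

Section pspin.
Context {R : realType} {N p : nat}.
Variables beta h : R.

Definition u_N : R := Num.sqrt (p`!%:R / (2 * N%:R ^+ p.-1)).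

(* A realisation of the disorder is a function [g : psites N p -> R]. *)
Definition hamiltonian (g : psites N p -> R) (s : config N) : R :=
  - (beta * u_N * (\sum_(t : psites N p) g t * \prod_(i <- val t) spin s i)
     + h * \sum_(i < N) spin s i).

Definition partition_function (g : psites N p -> R) : R :=
  \sum_(s : config N) expR (- hamiltonian g s).

Definition gibbs_average (g : psites N p -> R) {n : nat}
    (f : n.-tuple (config N) -> R) : R :=
  (partition_function g ^+ n)^-1 *
  \sum_(s : n.-tuple (config N))
    f s * expR (- \sum_(l < n) hamiltonian g (tnth s l)).

Definition nu {d : measure_display} {T : measurableType d}
    (P : probability T R) (g : psites N p -> {RV P >-> R}) {n : nat}
    (f : n.-tuple (config N) -> R) : \bar R :=
  ('E_P[(fun w => gibbs_average (fun t => g t w) f)%R])%E.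

End pspin.

Definition overlap {R : realType} {N n : nat} (l l' : 'I_n)
    (s : n.-tuple (config N)) : R :=
  N%:R^-1 * \sum_(i < N) spin (tnth s l) i * spin (tnth s l') i.

(* [Y] is the identity random variable on [R] under its standard Gaussian law. *)
Definition overlap_equation {R : realType} (p : nat) (beta h q : R) : Prop :=
  (q%:E = 'E_(normal_prob (0 : R) 1)[(fun y : R =>
    tanh (beta * Num.sqrt (p%:R / 2) * q `^ ((p%:R - 1) / 2) * y + h) ^+ 2)%R])%E.

(* Main.v *)
(** The cavity method, applied at each site [i] in turn. Replace the part of the
    Hamiltonian that contains the spin at [i] by an independent Gaussian field
    acting on that spin, of variance [beta^2 (p/2) q^(p-1)], and interpolate
    between the two with coefficients [sin th] and [cos th], [0 <= th <= pi/2].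
    At [th = 0] the spin at [i] is independent of the other spins, and the mean
    of [x_i], the product of its values in two replicas, is [q] by the equation
    for [q]. Gaussian integration by parts shows that the derivative in [th] is
    [sin th cos th] times a combination of averages involving two more replicas,
    weighted by the difference of the two covariances; this difference is
    [x_i beta^2 (p/2) (S^(p-1) - q^(p-1))] up to [O(1/N)], where [S] is the
    overlap with the site [i] left out.

    Averaging over [i] the resulting bound on [nu((x_i - q)(S - q))] gives
    [nu((R-q)^2) <= kappa nu((R-q)^2) + O(1/N)], with [kappa <= 3/4] by the choice
    of [beta_p], so that [nu((R-q)^2) = O(1/N)]. For [nu(x_i - q)], the derivative
    is moreover compared with its value at [th = 0], at the cost of a second
    moment; there the spin at [i] factors out and what remains is, again up to
    second moments, a multiple of [nu(S - q)]. Averaging over [i] yields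
    [|nu(R-q)| <= 3/4 |nu(R-q)| + O(1/N)]. *)

Require Import Defs.
From HB Require Import structures.
From mathcomp Require Import all_boot all_order all_algebra.
From mathcomp Require Import all_classical all_reals all_analysis.
From mathcomp Require Import measurable_realfun ring lra.
Import Order.TTheory GRing.Theory Num.Theory.
Import numFieldNormedType.Exports.
Local Open Scope classical_set_scope.
Local Open Scope ring_scope.
Set Implicit Arguments.
Unset Strict Implicit.
Unset Printing Implicit Defensive.

(** Treating all sites, and not just the last one, dispenses with the symmetry between sites:
    [R - q] is the mean over [i] of [x_i - q], so bounds uniform in [i] are enough. The second
    moment has to come first, because keeping only the linear part of [S^(p-1) - q^(p-1)] leaves a
    quadratic error. The obstacle is that derivatives involve moments at every [th], while only
    [th = pi / 2] carries the true Gibbs measure. A Gronwall inequality brings the second moments at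
    other [th] back to that end and costs the factor [expR (12 * (beta ^+ 2 * p%:R))]; the
    exponential in the equation for [beta_p] absorbs it. Gaussian integration by parts is stated
    only against Gibbs averages of affine fields. In this form it passes from single variables to
    the whole disorder and to the disorder with one more variable, without any multivariate Gaussian
    law. *)

Lemma is_derive_bigsum {R : realType} (I : Type) (r : seq I) (P : pred I)
    (h : I -> R -> R) (dh : I -> R) (x : R) :
  (forall i, is_derive x 1 (h i) (dh i)) ->
  is_derive x 1 (fun u => \sum_(i <- r | P i) h i u) (\sum_(i <- r | P i) dh i).
Proof.
move=> hd; rewrite (_ : (fun u => _) = \sum_(i <- r | P i) h i); last first.
  by apply/funext => u; rewrite fct_sumE.
by elim/big_ind2 : _ => // [|] *; [exact: is_derive_cst|exact: is_deriveD].
Qed.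

(** * Averages over independent replicas *)

Section ReplicaAverage.
Context {R : realType} {S : finType}.
Variable s0 : S.
Implicit Types (G : S -> R) (f g : (nat -> S) -> R) (n l : nat) (sg : nat -> S).

Definition scons (s : S) (sg : nat -> S) : nat -> S :=
  fun l => if l is l'.+1 then sg l' else s.

(* Replicas are indexed by all of [nat]; [avg G n] averages the first [n] of
   them independently under [G] and sets the others to the junk value [s0]. *)
Fixpoint avg G n f : R :=
  if n is n'.+1 then \sum_s G s * avg G n' (fun sg => f (scons s sg))
  else f (fun=> s0).

(** An average over [n] replicas of such an [f] never sees the junk value [s0], so averaging over
    more replicas does not change it. *)
Definition depends n f :=
  forall sg sg', (forall l, (l < n)%N -> sg l = sg' l) -> f sg = f sg'.

Lemma depends_scons n f s :
  depends n.+1 f -> depends n (fun sg => f (scons s sg)).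
Proof. by move=> df sg sg' e; apply: df => -[//|l] ln /=; apply: e. Qed.

Lemma depends_le m n f : (m <= n)%N -> depends m f -> depends n f.
Proof. by move=> mn df sg sg' e; apply: df => l lm; apply/e/(leq_trans lm). Qed.

Lemma dependsM n f g : depends n f -> depends n g ->
  depends n (fun sg => f sg * g sg).
Proof. by move=> df dg sg sg' e; rewrite (df _ _ e) (dg _ _ e). Qed.

Lemma avg_sum (I : Type) (r : seq I) (P : pred I) G n (F : I -> (nat -> S) -> R) :
  avg G n (fun sg => \sum_(i <- r | P i) F i sg) =
  \sum_(i <- r | P i) avg G n (F i).
Proof.
elim: n F => [//|n IH] F /=.
under eq_bigr do rewrite IH mulr_sumr.
by rewrite exchange_big.
Qed.

Lemma avgZ G n c f : avg G n (fun sg => c * f sg) = c * avg G n f.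
Proof.
elim: n f => [//|n IH] f /=.
by rewrite mulr_sumr; apply: eq_bigr => s _; rewrite IH mulrCA.
Qed.

Lemma avgD G n f g : avg G n (fun sg => f sg + g sg) = avg G n f + avg G n g.
Proof.
elim: n f g => [//|n IH] f g /=.
by rewrite -big_split; apply: eq_bigr => s _; rewrite IH mulrDr.
Qed.

Lemma avgB G n f g : avg G n (fun sg => f sg - g sg) = avg G n f - avg G n g.
Proof.
rewrite -mulN1r -avgZ -avgD.
by congr avg; apply/funext => sg; rewrite mulN1r.
Qed.

(** [avg] reads [f] only at the finitely many sequences that equal [s0] from [n] on. The bound is
    uniform in the weights, which makes random averages integrable. *)
Lemma avg_le1_bounded n f :
  exists C : R, forall G, (forall s, 0 <= G s) -> \sum_s G s = 1 ->
    `|avg G n f| <= C.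
Proof.
elim: n f => [|n IH] f; first by exists `|f (fun=> s0)|.
have /choice[C CP] : forall s, exists C : R, forall G, (forall s, 0 <= G s) ->
    \sum_s G s = 1 -> `|avg G n (fun sg => f (scons s sg))| <= C.
  by move=> s; apply: IH.
exists (\sum_s C s) => G G0 G1 /=.
rewrite (le_trans (ler_norm_sum _ _ _))//; apply: ler_sum => s _.
rewrite normrM (ger0_norm (G0 s)) (le_trans _ (CP s G G0 G1))// ler_piMl//.
by rewrite -G1 (bigD1 s)//= lerDl sumr_ge0.
Qed.

Section Weights.
Variable G : S -> R.
Hypothesis G_ge0 : forall s, 0 <= G s.
Hypothesis G_sum1 : \sum_s G s = 1.

Lemma ler_avg n f g : (forall sg, f sg <= g sg) -> avg G n f <= avg G n g.
Proof.
elim: n f g => [|n IH] f g fg /=; first exact: fg.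
by apply: ler_sum => s _; rewrite ler_wpM2l//; apply: IH.
Qed.

Lemma avg_cst n c : avg G n (fun=> c) = c.
Proof. by elim: n => [//|n IH] /=; rewrite IH -mulr_suml G_sum1 mul1r. Qed.

Lemma ler_norm_avg n f : `|avg G n f| <= avg G n (fun sg => `|f sg|).
Proof.
elim: n f => [//|n IH] f /=.
rewrite (le_trans (ler_norm_sum _ _ _))//; apply: ler_sum => s _.
by rewrite normrM (ger0_norm (G_ge0 s)) ler_wpM2l.
Qed.

Lemma avg_bound n f c : (forall sg, `|f sg| <= c) -> `|avg G n f| <= c.
Proof.
move=> fc; rewrite (le_trans (ler_norm_avg _ _))// -[leRHS](avg_cst n).
exact: ler_avg.
Qed.

(** Replica [n] is independent of the first [n]. Read from right to left, a product with a mean of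
    [a] becomes a single average with one more replica. *)
Lemma avg_mul_last n f (a : S -> R) : depends n f ->
  avg G n.+1 (fun sg => f sg * a (sg n)) = avg G n f * \sum_s G s * a s.
Proof.
elim: n f => [|n IH] f df.
  rewrite /= mulr_sumr; apply: eq_bigr => s _.
  by rewrite (df _ (fun=> s0))// mulrCA.
rewrite [LHS]/= [avg G n.+1 f]/= mulr_suml; apply: eq_bigr => s _.
rewrite -mulrA -IH//; exact: depends_scons.
Qed.

Lemma avg_widen n m f : (n <= m)%N -> depends n f -> avg G m f = avg G n f.
Proof.
move=> nm df; rewrite -(subnK nm); elim: (m - n)%N => [//|k IH].
rewrite addSn -{}IH.
have := @avg_mul_last (k + n) f (fun=> 1) (depends_le (leq_addl _ _) df).
rewrite -mulr_suml G_sum1 mul1r mulr1 => <-.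
by congr avg; apply/funext => sg; rewrite mulr1.
Qed.

Lemma avg_marg1 n l (a : S -> R) : (l < n)%N ->
  avg G n (fun sg => a (sg l)) = \sum_s G s * a s.
Proof.
elim: n l => [//|n IH] [_|l] /=.
  by apply: eq_bigr => s _; rewrite avg_cst.
by move=> ln; rewrite IH// -mulr_suml G_sum1 mul1r.
Qed.

(** Replicas are independent with a common law; this collapses the moments of all pairs onto the
    pair [0], [1]. *)
Lemma avg_marg2 n l m (a : S -> S -> R) : (l < n)%N -> (m < n)%N -> l != m ->
  avg G n (fun sg => a (sg l) (sg m)) = avg G 2 (fun sg => a (sg 0%N) (sg 1%N)).
Proof.
wlog lm : l m a / (l < m)%N.
  move=> W ln mn; rewrite neq_ltn => /orP[] lm.
    by apply: W => //; rewrite ltn_eqF.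
  rewrite (W m l (fun s t => a t s)) ?ltn_eqF// /=.
  under eq_bigr do rewrite mulr_sumr.
  rewrite exchange_big/=; apply: eq_bigr => s _; rewrite mulr_sumr.
  by apply: eq_bigr => t _; rewrite mulrCA.
move=> ln mn _; elim: n l m ln mn lm => [//|n IH] [|l] [//|m] ln mn lm.
  by rewrite [LHS]/=; apply: eq_bigr => s _; rewrite avg_marg1.
by rewrite [LHS]/= IH// -mulr_suml G_sum1 mul1r.
Qed.

End Weights.

End ReplicaAverage.

(** * Gibbs weights and their derivatives *)

Section Gibbs.
Context {R : realType} {S : finType}.
Variable s0 : S.
Implicit Types (H a : S -> R) (n l : nat).

Definition gibbs H (s : S) : R := expR (H s) / \sum_t expR (H t).

Lemma sum_expR_gt0 H : 0 < \sum_t expR (H t).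
Proof.
rewrite (bigD1 s0)//= ltr_wpDr ?expR_gt0//.
by apply: sumr_ge0 => *; exact: expR_ge0.
Qed.

Lemma gibbs_ge0 H s : 0 <= gibbs H s.
Proof. by rewrite divr_ge0 ?expR_ge0// ltW// sum_expR_gt0. Qed.

Lemma gibbs_sum1 H : \sum_s gibbs H s = 1.
Proof. by rewrite -mulr_suml divff// gt_eqF// sum_expR_gt0. Qed.

(* In the derivative of an average over [n] replicas, replica [n] is the one that
   comes from differentiating the normalisations. *)
Definition dcoef n l : R := if l == n then - n%:R else 1.

Definition dreplica n a (sg : nat -> S) : R := \sum_(l < n.+1) dcoef n l * a (sg l).

Lemma dreplica_bound n a c sg : (forall s, `|a s| <= c) ->
  `|dreplica n a sg| <= n%:R *+ 2 * c.
Proof.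
move=> ac; rewrite /dreplica big_ord_recr/= {2}/dcoef eqxx.
rewrite (le_trans (ler_normD _ _))// mulr2n mulrDl lerD//; last first.
  by rewrite mulNr normrN normrM ger0_norm// ler_wpM2l.
rewrite (le_trans (ler_norm_sum _ _ _))//.
rewrite (le_trans (ler_sum _ (G := fun=> c) _)) //.
  by move=> l _; rewrite /dcoef ltn_eqF// mul1r.
by rewrite sumr_const card_ord mulr_natl.
Qed.

Lemma dependsD n a : depends n.+1 (dreplica n a).
Proof. by move=> sg sg' e; apply: eq_bigr => l _; rewrite e. Qed.

Lemma is_derive_gibbs (H : R -> S -> R) (dH : S -> R) (x : R) s :
  (forall s, is_derive x 1 (H^~ s) (dH s)) ->
  is_derive x 1 (fun u => gibbs (H u) s)
    (gibbs (H x) s * (dH s - \sum_t gibbs (H x) t * dH t)).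
Proof.
move=> HH.
have HE t : is_derive x 1 (fun u => expR (H u t)) (expR (H x t) * dH t).
  have := @is_derive1_comp R expR (H^~ t) x _ _ (is_derive_expR _) (HH t).
  by [].
have HZ : is_derive x 1 (fun u => \sum_t expR (H u t)) (\sum_t expR (H x t) * dH t).
  exact: is_derive_bigsum.
have Z0 : \sum_t expR (H x t) != 0 by rewrite gt_eqF// sum_expR_gt0.
have HV := is_deriveV Z0 HZ.
have := @is_deriveM _ _ _ _ x 1 _ _ (HE s) HV.
move=> /is_derive_eq; apply.
rewrite /gibbs /GRing.scale /=.
set Z := \sum_t expR (H x t) in Z0 *.
have -> : \sum_t expR (H x t) / Z * dH t = (\sum_t expR (H x t) * dH t) / Z.
  by rewrite mulr_suml; apply: eq_bigr => t _; rewrite mulrAC.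
by field.
Qed.

Lemma is_derive_avg (H : R -> S -> R) (dH : S -> R) (x : R) n f :
  (forall s, is_derive x 1 (H^~ s) (dH s)) -> depends n f ->
  is_derive x 1 (fun u => avg s0 (gibbs (H u)) n f)
    (avg s0 (gibbs (H x)) n.+1 (fun sg => f sg * dreplica n dH sg)).
Proof.
move=> HH; elim: n f => [|n IH] f df.
  rewrite /= big1; first exact: is_derive_cst.
  by move=> s _; rewrite /dreplica big_ord1 /dcoef eqxx oppr0 mul0r !mulr0.
pose fs s sg := f (scons s sg).
have dfs s : depends n (fs s) by exact: depends_scons.
have Dg s := is_derive_gibbs s HH.
have := is_derive_bigsum (index_enum S) predT (fun s => @is_deriveM _ _ _ _ x 1 _ _ (Dg s) (IH _ (dfs s))).
move=> /is_derive_eq; apply.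
rewrite [RHS](_ : _ = \sum_s gibbs (H x) s * avg s0 (gibbs (H x)) n.+1
  (fun sg => f (scons s sg) * dreplica n.+1 dH (scons s sg)))//.
apply: eq_bigr => s _; transitivity (gibbs (H x) s * avg s0 (gibbs (H x)) n.+1
    (fun sg => fs s sg * dreplica n dH sg) +
  avg s0 (gibbs (H x)) n (fs s) *
    (gibbs (H x) s * (dH s - \sum_t gibbs (H x) t * dH t))) => //.
(* Prepending a replica changes the last coefficient from [- n] to [- n.+1]; the additional [- 1] is
   the term that the normalisation of the new replica contributes. *)
have -> : (fun sg => f (scons s sg) * dreplica n.+1 dH (scons s sg)) =
   (fun sg => (dH s * fs s sg + fs s sg * dreplica n dH sg) - fs s sg * dH (sg n)).
  apply/funext => sg; rewrite /dreplica big_ord_recl/= /dcoef/=.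
  rewrite !big_ord_recr/= !eqxx /bump /=.
  under eq_bigr => l _ do rewrite add1n eqSS ltn_eqF// mul1r.
  under [X in _ = _ + _ * (X + _) - _]eq_bigr => l _ do rewrite ltn_eqF// mul1r.
  by rewrite -/(fs s sg) -natr1; ring.
rewrite avgB avgD avgZ avg_mul_last//.
rewrite (@avg_widen _ _ s0 _ (gibbs_sum1 _) n n.+1 (fs s))//.
have E (a b c y z : R) : y * a + b * (y * (z - c)) = y * (z * b + a - b * c).
  by ring.
exact: E.
Qed.

End Gibbs.

(** * Integration by parts for one Gaussian variable *)

Section StandardNormal.
Context {R : realType}.
Let mu := @lebesgue_measure R.
Let gam := @normal_prob R 0 1.
Let phi := @normal_pdf R 0 1.

Let mphi : measurable_fun setT (EFin \o phi : measurableTypeR R -> \bar R).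
Proof. by apply/measurable_EFinP; exact: measurable_normal_pdf. Qed.

Let phi_ge0 x : (0 <= (phi x)%:E)%E.
Proof. by rewrite lee_fin normal_pdf_ge0. Qed.

Let integral_indic_normal_prob (E : set (measurableTypeR R)) : measurable E ->
  (\int[gam]_x (\1_E x)%:E = \int[mu]_x ((\1_E x)%:E * (phi x)%:E))%E.
Proof.
move=> mE; rewrite integral_indic//= setIT /gam /normal_prob integral_mkcond.
apply: eq_integral => x _; rewrite patchE indicE; case: ifPn => xE.
  by rewrite mul1e.
by rewrite mul0e.
Qed.

Import HBNNSimple.

Let integral_nnsfun_normal_prob (f : {nnsfun (measurableTypeR R) >-> R}) :
  (\int[gam]_x (f x)%:E = \int[mu]_x ((f x)%:E * (phi x)%:E))%E.
Proof.
under [LHS]eq_integral do rewrite fimfunE -fsumEFin//.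
rewrite [LHS]ge0_integral_fsum//; last 2 first.
  - by move=> r; exact/measurable_EFinP/measurableT_comp.
  - by move=> n x _; rewrite EFinM nnfun_muleindic_ge0.
under [RHS]eq_integral.
  move=> x xD; rewrite fimfunE -fsumEFin// ge0_mule_fsuml; last first.
    by move=> r; rewrite EFinM nnfun_muleindic_ge0.
  over.
rewrite [RHS]ge0_integral_fsum//; last 2 first.
  - move=> r; apply: emeasurable_funM => //.
    by apply/measurable_EFinP; do 2 apply/measurableT_comp => //.
  - by move=> n x _; rewrite mule_ge0// EFinM nnfun_muleindic_ge0.
apply: eq_fsbigr => r _.
have [r0|r0] := leP 0 r; last first.
  rewrite preimage_nnfun0// indic0 [LHS]integral0_eq ?[RHS]integral0_eq// => x _.
    by rewrite mulr0 mul0e.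
  by rewrite mulr0.
under eq_integral do rewrite EFinM.
rewrite ge0_integralZl//; last first.
- exact/measurable_EFinP/measurable_indic.
rewrite integral_indic_normal_prob//.
under [RHS]eq_integral do rewrite EFinM -muleA.
rewrite ge0_integralZl//.
- apply: emeasurable_funM => //; exact/measurable_EFinP/measurable_indic.
- by move=> x _; rewrite mule_ge0// lee_fin.
Qed.

Lemma ge0_integral_normal_prob (f : measurableTypeR R -> \bar R) :
  measurable_fun setT f -> (forall x, (0 <= f x)%E) ->
  (\int[gam]_x f x = \int[mu]_x (f x * (phi x)%:E))%E.
Proof.
move=> mf f0.
pose f_ := nnsfun_approx measurableT mf.
have sfE n : (\int[gam]_x (f_ n x)%:E = \int[mu]_x ((f_ n x)%:E * (phi x)%:E))%E.
  exact: integral_nnsfun_normal_prob.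
transitivity (lim (\int[gam]_x (f_ n x)%:E @[n --> \oo])%E).
  rewrite -monotone_convergence//=.
  - by apply: eq_integral => x _; apply/esym/cvg_lim => //=; exact: cvg_nnsfun_approx.
  - by move=> n; exact/measurable_EFinP/measurable_funTS.
  - by move=> n ? _; rewrite lee_fin.
  - by move=> ? _ ? ? mn; rewrite lee_fin; exact/lefP/nd_nnsfun_approx.
transitivity (lim (\int[mu]_x ((f_ n x)%:E * (phi x)%:E) @[n --> \oo])%E).
  by apply: congr_lim; apply/funext => n /=; exact: sfE.
rewrite -monotone_convergence//=.
- apply: eq_integral => x _; apply/cvg_lim => //=.
  by apply: cvgeZr => //; exact: cvg_nnsfun_approx.
- move=> n; apply: emeasurable_funM => //.
  exact/measurable_EFinP/measurable_funTS.
- by move=> n x _; rewrite mule_ge0// lee_fin.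
- by move=> x _ m n mn; rewrite lee_wpmul2r// lee_fin; exact/lefP/nd_nnsfun_approx.
Qed.

Lemma normal_pdfE01 x : phi x = (Num.sqrt (pi *+ 2))^-1 * expR (- (x ^+ 2) / 2).
Proof.
rewrite /phi normal_pdfE ?oner_neq0// /normal_peak /normal_fun.
by rewrite expr1n mul1r subr0.
Qed.

Lemma is_derive_normal_pdf (x : R) : is_derive x (1:R) phi (- x * phi x).
Proof.
rewrite (_ : phi = fun y => (Num.sqrt (pi *+ 2))^-1 * expR (- (y ^+ 2) / 2)); last first.
  by apply/funext => y; exact: normal_pdfE01.
have H : is_derive x (1:R) (fun y : R => - (y ^+ 2) / 2) (- x).
  apply: is_derive_eq; rewrite /GRing.scale/=; lra.
have H2 := is_derive1_comp (is_derive_expR _) H.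
apply: is_derive_eq.
rewrite /GRing.scale/=; ring.
Qed.

(** Since [|x| <= expR (x ^+ 2 / 4)], a multiple of the Gaussian density of variance [2]
    dominates. *)
Lemma integrable_normal_pdf_id : mu.-integrable setT (fun x => (x * phi x)%:E).
Proof.
pose c : R := (Num.sqrt (pi *+ 2))^-1.
pose s : R := Num.sqrt 2.
have s0 : s != 0 by rewrite gt_eqF// sqrtr_gt0.
have H := integrable_normal_pdf 0 s.
have c0 : 0 <= c by rewrite invr_ge0.
have H2 : mu.-integrable setT (fun x => (c / normal_peak s)%:E * (normal_pdf 0 s x)%:E)%E.
  exact: integrableZl.
apply: (le_integrable _ _ _ H2) => //.
  apply/measurable_EFinP/measurable_funM => //.
  exact: measurable_normal_pdf.
move=> x _; rewrite -EFinM !abse_EFin lee_fin.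
rewrite normal_pdfE// normal_pdfE01 -/c !normrM.
rewrite mulrA (ger0_norm c0) [_ * c]mulrC -!mulrA ler_wpM2l//.
have np : 0 < normal_peak s by exact: normal_peak_gt0.
rewrite normfV mulKf ?normr_eq0 ?gt_eqF//.
rewrite /normal_fun subr0 !(ger0_norm (expR_ge0 _)).
have -> : s ^+ 2 = 2 by rewrite /s sqr_sqrtr.
have -> : - x ^+ 2 / 2 = - (x ^+ 2 / 4) + (- x ^+ 2 / (2 *+ 2)) by lra.
rewrite expRD mulrA ler_piMl ?expR_ge0// expRN ler_pdivrMr ?expR_gt0// mul1r.
rewrite (le_trans _ (expR_ge1Dx _))//.
have := sqr_ge0 (`|x| / 2 - 1); rewrite sqrrB expr_div_n real_normK ?num_real//; lra.
Qed.

(** The integrand is the derivative of [F * phi]: on a bounded interval only boundary terms remain,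
    and they vanish at infinity because [F] is bounded. *)
Lemma integral_derive_normal_pdf (F dF : R -> R) (C : R) :
  (forall x : R, is_derive x (1:R) F (dF x)) -> continuous dF ->
  (forall x, `|F x| <= C) -> (forall x, `|dF x| <= C) ->
  (\int[mu]_x ((dF x - x * F x) * phi x)%:E = 0)%E.
Proof.
move=> dFE cdF FC dFC.
pose k x := (dF x - x * F x) * phi x.
have cF : continuous F by move=> x; apply/differentiable_continuous/derivable1_diffP.
have cphi : continuous phi by apply: continuous_normal_pdf; exact: oner_neq0.
have ck : continuous k.
  move=> x; apply: cvgM; last exact: cphi.
  apply: cvgB; first exact: cdF.
  by apply: cvgM; [exact: cvg_id|exact: cF].
have dk (x : R) : is_derive x (1:R) (fun y => F y * phi y) (k x).
  apply: is_derive_eq (is_deriveM (dFE x) (is_derive_normal_pdf x)) _.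
  rewrite /k /GRing.scale/=; ring.
have mk : measurable_fun setT (k : measurableTypeR R -> R).
  exact: continuous_measurable_fun.
have C0 : 0 <= C by exact: le_trans (FC 0).
have ik : mu.-integrable setT (EFin \o k).
  have i1 := integrableZl measurableT C (integrable_normal_pdf (0:R) 1).
  have i2 := integrableZl measurableT C (integrable_abse integrable_normal_pdf_id).
  apply: (le_integrable _ _ _ (integrableD measurableT i1 i2)) => //.
    exact/measurable_EFinP.
  move=> x _.
  change (`|(k x)%:E| <= `|(C * phi x + C * `|x * phi x|)%:E|)%E.
  rewrite !abse_EFin lee_fin /k normrM.
  rewrite (ger0_norm (normal_pdf_ge0 _ _ _)) [leRHS]ger0_norm; last first.
    by rewrite addr_ge0 ?mulr_ge0// normal_pdf_ge0.
  rewrite normrM (ger0_norm (normal_pdf_ge0 _ _ _)).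
  rewrite [C * (_ * _)]mulrA -mulrDl ler_wpM2r ?normal_pdf_ge0//.
  rewrite (le_trans (ler_normB _ _))// lerD// normrM mulrC.
  by rewrite ler_wpM2r.
(* The shift by one keeps the interval nondegenerate at [n = 0] and makes the inverse of [a n] equal
   to [harmonic n]. *)
pose a (n : nat) : R := n.+1%:R.
have FTC (n : nat) : (\int[mu]_(x in `[(- a n)%R, a n]%classic) (k x)%:E =
    (F (a n) * phi (a n))%:E - (F (- a n) * phi (- a n))%:E)%E.
  have nn : - a n < a n by rewrite gtrN// ltr0n.
  have cFp x : {for x, continuous (fun y => F y * phi y)}.
    by apply: cvgM; [exact: cF|exact: cphi].
  rewrite (@continuous_FTC2 _ k (fun y => F y * phi y))//.
  - exact: continuous_subspaceT.
  - split => [x _|//|//]; first exact: ex_derive.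
      by apply: cvg_at_right_filter; exact: cFp.
    by apply: cvg_at_left_filter; exact: cFp.
  - by move=> x _; rewrite derive1E; exact: derive_val.
pose kn (n : nat) (x : measurableTypeR R) := ((k x) * \1_(`[(- a n)%R, a n]%classic) x)%:E.
have cv1 : (\int[mu]_x kn n x @[n --> \oo] --> \int[mu]_x (k x)%:E)%E.
  apply: (@dominated_cvg _ _ _ mu setT measurableT kn _ (fun x => `|(k x)%:E|)%E).
  - move=> n; apply/measurable_EFinP/measurable_funM => //; exact: measurable_indic.
  - move=> x _; apply: cvg_near_cst; near=> n.
    rewrite /kn indicE mem_set ?mulr1//= in_itv/= -ler_norml.
    rewrite (@le_trans _ _ n%:R)// ?ler_nat//; near: n; exact: nbhs_infty_ger.
  - by [].
  - exact: integrable_abse.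
  - move=> n x _; rewrite /kn abse_EFin lee_fin normrM ler_piMr//.
    by rewrite indicE; case: (_ \in _); rewrite ?normr1 ?normr0.
have cv2 : (\int[mu]_x kn n x @[n --> \oo] --> (0%:E : \bar R))%E.
  rewrite (_ : (fun n => _) = (fun n : nat => (F (a n) * phi (a n)
     - (F (- a n) * phi (- a n)))%:E)); last first.
    apply/funext => n; rewrite EFinB -FTC [RHS]integral_mkcond.
    apply: eq_integral => x _; rewrite patchE /kn indicE.
    by case: ifPn => _; rewrite ?mulr1 ?mulr0.
  apply: cvg_EFin; first exact: nearW.
  (* From [expR (a ^+ 2 / 2) >= 1 + a ^+ 2 / 2 >= a], the density at [a n] is below a multiple of
     [harmonic n]. *)
  have phi_cv : phi (a n) @[n --> \oo] --> (0:R).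
    apply: (@squeeze_cvgr _ _ _ _ (cst 0)
      (fun n : nat => (Num.sqrt (pi *+ 2))^-1 * harmonic n)).
    - apply: nearW => n; rewrite normal_pdf_ge0/= normal_pdfE01 ler_wpM2l ?invr_ge0//.
      have an0 : 0 < a n by rewrite ltr0n.
      rewrite mulNr expRN lef_pV2 ?posrE ?expR_gt0//.
      rewrite (le_trans _ (expR_ge1Dx _))//.
      have := sqr_ge0 (a n - 1); rewrite sqrrB; rewrite -/(a n); lra.
    - exact: cvg_cst.
    - rewrite -[X in _ --> X](mulr0 (Num.sqrt (pi *+ 2))^-1).
      by apply: cvgMr; exact: cvg_harmonic.
  have phiN (x : R) : phi (- x) = phi x by rewrite !normal_pdfE01 sqrrN.
  apply: (@squeeze_cvgr _ _ _ _ (fun n : nat => - (2 * C * phi (a n)))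
     (fun n : nat => 2 * C * phi (a n))).
  - apply: nearW => n /=; rewrite -ler_norml phiN -mulrBl normrM.
    rewrite (ger0_norm (normal_pdf_ge0 _ _ _)) ler_wpM2r ?normal_pdf_ge0//.
    by rewrite (le_trans (ler_normB _ _))// mulr2n mulrDl mul1r lerD.
  - rewrite -oppr0; apply: cvgN; rewrite -(mulr0 (2 * C)); apply: cvgMr => //.
  - rewrite -(mulr0 (2 * C)); apply: cvgMr => //.
exact: (cvg_unique _ cv1 cv2).
Unshelve. all: end_near. Qed.

Lemma integral_normal_prob (f : measurableTypeR R -> R) :
  measurable_fun setT f ->
  (\int[gam]_x (f x)%:E = \int[mu]_x (f x * phi x)%:E)%E.
Proof.
move=> mf; rewrite integralE [RHS]integralE.
have mEf : measurable_fun setT (EFin \o f) by exact/measurable_EFinP.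
rewrite !ge0_integral_normal_prob//; first last.
- exact: measurable_funepos.
- exact: measurable_funeneg.
have phi0 x : 0 <= phi x by exact: normal_pdf_ge0.
congr (_ - _)%E; apply: eq_integral => x _.
- rewrite !funeposE/= -!EFin_max -EFinM; congr EFin.
  by rewrite maxr_pMl// mul0r.
- rewrite !funenegE/= -!EFin_max -EFinM; congr EFin.
  by rewrite maxr_pMl// mul0r mulNr.
Qed.

Let measurable_norm : measurable_fun setT (Num.norm : measurableTypeR R -> R).
Proof.
suff : measurable_fun setT (Num.norm : R -> R) by [].
by apply: continuous_measurable_fun; exact: norm_continuous.
Qed.

Section RandomVariable.
Context d (T : measurableType d) (P : probability T R) (X : {RV P >-> R}).
Hypothesis X_gauss : standard_gaussian X.

Let X' : T -> measurableTypeR R := X.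

Let mX' : measurable_fun setT X'.
Proof. have mX : measurable_fun setT (X : T -> R) by []. exact: mX. Qed.

Let pushX (f : measurableTypeR R -> \bar R) :
  (\int[pushforward P X']_x f x = \int[gam]_x f x)%E.
Proof. by apply: eq_measure_integral => A mA _; exact: X_gauss. Qed.

Lemma integrable_standard_gaussian : P.-integrable setT (EFin \o X).
Proof.
apply/integrableP; split; first exact/measurable_EFinP.
have := @ge0_integral_pushforward _ _ _ _ _ _ mX' P setT (fun x => `|x|%:E)%E measurableT.
rewrite preimage_setT pushX integral_normal_prob//.
move=> <-//.
- have /integrableP[_] := integrable_normal_pdf_id; apply: le_lt_trans.
  rewrite le_eqVlt; apply/orP; left; apply/eqP; apply: eq_integral => x _.
  by rewrite /= normrM (ger0_norm (normal_pdf_ge0 _ _ _)).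
- by apply/measurable_EFinP; exact: measurable_norm.
Qed.

Lemma integral_standard_gaussian (f : R -> R) : measurable_fun setT f ->
  P.-integrable setT (EFin \o f \o X) ->
  (\int[P]_w (f (X w))%:E = \int[gam]_x (f x)%:E)%E.
Proof.
move=> mf fi.
have mf' : measurable_fun setT (EFin \o f : measurableTypeR R -> _).
  by apply/measurable_EFinP; exact: mf.
by have := integral_pushforward mX' mf' fi measurableT; rewrite pushX preimage_setT => ->.
Qed.

Lemma gaussian_integration_by_parts (F dF : R -> R) (C : R) :
  (forall x : R, is_derive x (1:R) F (dF x)) -> continuous dF ->
  (forall x, `|F x| <= C) -> (forall x, `|dF x| <= C) ->
  \int[P]_w (X w * F (X w)) = \int[P]_w dF (X w).
Proof.
move=> dFE cdF FC dFC.
have cF : continuous F by move=> x; apply/differentiable_continuous/derivable1_diffP.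
have mF : measurable_fun setT F by exact: continuous_measurable_fun.
have mdF : measurable_fun setT dF by exact: continuous_measurable_fun.
have mX : measurable_fun setT (X : T -> R) by [].
have i1 : P.-integrable setT (EFin \o (fun w => dF (X w))).
  apply: (@le_integrable _ _ _ P setT _ _ (cst C%:E)) => //.
  - by apply/measurable_EFinP; exact: measurableT_comp.
  - by move=> w _; rewrite /= lee_fin (le_trans (dFC _))// ler_norm.
  - exact: finite_measure_integrable_cst.
have i2 : P.-integrable setT (EFin \o (fun w => X w * F (X w))).
  apply: (@le_integrable _ _ _ P setT _ _ (fun w => C%:E * (X w)%:E)%E) => //.
  - by apply/measurable_EFinP; apply: measurable_funM => //; exact: measurableT_comp.
  - move=> w _; change (`|(X w * F (X w))%:E| <= `|(C * X w)%:E|)%E.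
    rewrite !abse_EFin lee_fin !normrM mulrC ler_wpM2r//.
    by rewrite (le_trans (FC _))// ler_norm.
  - by apply: integrableZl => //; exact: integrable_standard_gaussian.
apply/eqP; rewrite eq_sym -subr_eq0 -RintegralB//; apply/eqP.
rewrite /Rintegral (integral_standard_gaussian (f := fun x => dF x - x * F x)).
- rewrite integral_normal_prob.
    by rewrite (integral_derive_normal_pdf dFE cdF FC dFC).
  suff : measurable_fun setT (fun x : R => dF x - x * F x) by [].
  by apply: measurable_funB => //; apply: measurable_funM.
- by apply: measurable_funB => //; apply: measurable_funM.
- rewrite (_ : _ \o _ = (fun w => (dF (X w))%:E - (X w * F (X w))%:E)%E).
    exact: integrableB.
  by apply/funext => w.
Qed.

End RandomVariable.

End StandardNormal.

Lemma depends_bounded {R : realType} {S : finType} n (f : (nat -> S) -> R) :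
  depends n f -> exists C : R, forall sg, `|f sg| <= C.
Proof.
elim: n f => [|n IH] f df.
  have [[sg0]|noS] := pselect (inhabited (nat -> S)).
    by exists `|f sg0| => sg; rewrite (df sg sg0).
  by exists 0 => sg; exfalso; apply: noS.
have /choice[C CP] : forall s, exists C, forall sg, `|f (scons s sg)| <= C.
  by move=> s; apply: IH; exact: depends_scons.
exists (\sum_s `|C s|) => sg.
rewrite (df _ (scons (sg 0%N) (fun l => sg l.+1))); last by move=> [].
rewrite (le_trans (CP _ _))// (bigD1 (sg 0%N))//= (le_trans (ler_norm _))// lerDl.
exact: sumr_ge0.
Qed.

(** * Integrability, measurability and Fubini for real-valued integrals *)

Section Integrability.
Context {R : realType} d (T : measurableType d) (P : probability T R).

Lemma integrable_bounded (F : T -> R) C :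
  measurable_fun setT F -> (forall w, `|F w| <= C) ->
  P.-integrable setT (EFin \o F).
Proof.
move=> mF FC; apply: (@le_integrable _ _ _ P setT _ _ (cst C%:E)) => //.
- exact/measurable_EFinP.
- by move=> w _; rewrite /= lee_fin (le_trans (FC _))// ler_norm.
- exact: finite_measure_integrable_cst.
Qed.

Lemma integrableM_bounded (X F : T -> R) C :
  P.-integrable setT (EFin \o X) -> measurable_fun setT F ->
  (forall w, `|F w| <= C) -> P.-integrable setT (EFin \o (fun w => X w * F w)).
Proof.
move=> iX mF FC.
have mX : measurable_fun setT X by apply/measurable_EFinP/(measurable_int _ iX).
apply: (@le_integrable _ _ _ P setT _ _ (fun w => C%:E * (X w)%:E)%E) => //.
- by apply/measurable_EFinP; exact: measurable_funM.
- move=> w _; change (`|(X w * F w)%:E| <= `|(C * X w)%:E|)%E.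
  rewrite !abse_EFin lee_fin !normrM mulrC ler_wpM2r//.
  by rewrite (le_trans (FC _))// ler_norm.
- exact: integrableZl.
Qed.

Lemma measurable_sum_fin (I : Type) (r : seq I) (F : I -> T -> R) :
  (forall i, measurable_fun setT (F i)) ->
  measurable_fun setT (fun w => \sum_(i <- r) F i w).
Proof.
move=> mF; elim: r => [|i r IH].
  by under eq_fun do rewrite big_nil; exact: measurable_cst.
by under eq_fun do rewrite big_cons; exact: measurable_funD.
Qed.

Lemma integrable_bigsum (I : Type) (r : seq I) (F : I -> T -> R) :
  (forall i, P.-integrable setT (EFin \o F i)) ->
  P.-integrable setT (EFin \o (fun w => \sum_(i <- r) F i w)).
Proof.
move=> iF; elim: r => [|i r IH].
  rewrite (_ : _ \o _ = cst 0%E); first exact: integrable0.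
  by apply/funext => w; rewrite /= big_nil.
rewrite (_ : _ \o _ = (fun w => (F i w)%:E + (\sum_(i <- r) F i w)%:E)%E).
  by apply: integrableD => //; exact: iF.
by apply/funext => w; rewrite /= big_cons.
Qed.

Lemma Rintegral_bigsum (I : Type) (r : seq I) (F : I -> T -> R) :
  (forall i, P.-integrable setT (EFin \o F i)) ->
  \int[P]_w (\sum_(i <- r) F i w) = \sum_(i <- r) \int[P]_w F i w.
Proof.
move=> iF; elim: r => [|i r IH].
  rewrite big_nil; under eq_Rintegral do rewrite big_nil.
  by rewrite (Rintegral_cst P measurableT 0) mul0r.
rewrite big_cons -IH; under eq_Rintegral do rewrite big_cons.
by rewrite RintegralD//; exact: integrable_bigsum.
Qed.

End Integrability.

Section MeasurableGibbs.
Context {R : realType} {S : finType} (s0 : S) d (T : measurableType d).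

Lemma measurable_avg (G : T -> S -> R) n f :
  (forall s, measurable_fun setT (G^~ s)) ->
  measurable_fun setT (fun w => avg s0 (G w) n f).
Proof.
move=> mG; elim: n f => [|n IH] f /=; first exact: measurable_cst.
by apply: measurable_sum_fin => s; exact: measurable_funM.
Qed.

Lemma measurable_gibbs (H : T -> S -> R) s :
  (forall s, measurable_fun setT (H^~ s)) ->
  measurable_fun setT (fun w => gibbs (H w) s).
Proof.
move=> mH.
have mE t : measurable_fun setT (fun w => expR (H w t)) by exact: measurableT_comp.
rewrite (_ : (fun w => _) = (fun w => expR (H w s - ln (\sum_t expR (H w t))))).
  apply: measurableT_comp => //; apply: measurable_funB => //.
  by apply: measurableT_comp => //; exact: measurable_sum_fin.
apply/funext => w; rewrite expRB lnK ?posrE//; exact: sum_expR_gt0.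
Qed.

End MeasurableGibbs.

Section Fubini.
Context {R : realType} d1 d2 (T1 : measurableType d1) (T2 : measurableType d2).
Variables (P1 : probability T1 R) (P2 : probability T2 R).
Variable F : T1 * T2 -> R.
Hypothesis iF : (P1 \x P2)%E.-integrable setT (EFin \o F).

(** Sections are integrable at every point, not just almost everywhere, so each inner integral is
    finite and can be replaced by its real value. *)
Lemma Rfubini12 : (forall x, P2.-integrable setT (fun y => (F (x, y))%:E)) ->
  \int[(P1 \x P2)%E]_z F z = \int[P1]_x \int[P2]_y F (x, y).
Proof.
move=> i2; rewrite /Rintegral -(integral12_prod_meas1 iF); congr fine.
apply: eq_integral => x _; rewrite /fubini_F fineK//.
exact: integrable_fin_num.
Qed.

Lemma Rfubini21 : (forall y, P1.-integrable setT (fun x => (F (x, y))%:E)) ->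
  \int[(P1 \x P2)%E]_z F z = \int[P2]_y \int[P1]_x F (x, y).
Proof.
move=> i1; rewrite /Rintegral -(integral21_prod_meas1 iF); congr fine.
apply: eq_integral => y _; rewrite /fubini_G fineK//.
exact: integrable_fin_num.
Qed.

End Fubini.

Lemma integrable_prod_fst {R : realType} d1 d2 (T1 : measurableType d1)
    (T2 : measurableType d2) (P1 : probability T1 R) (P2 : probability T2 R)
    (X : T1 -> R) : P1.-integrable setT (EFin \o X) ->
  (P1 \x P2)%E.-integrable setT (EFin \o (fun z => X z.1)).
Proof.
move=> iX.
have mX : measurable_fun setT X by apply/measurable_EFinP/(measurable_int _ iX).
apply/integrable12ltyP.
  by apply/measurable_EFinP; exact: measurableT_comp.
have /integrableP[_] := iX; apply: le_lt_trans.
rewrite le_eqVlt; apply/orP; left; apply/eqP; apply: eq_integral => x _ /=.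
rewrite (integral_cst P2 measurableT `|X x|%:E).
by rewrite [X in (_ * X)%E](@probability_setT _ _ _ P2) mule1.
Qed.

Lemma integrable_prod_snd {R : realType} d1 d2 (T1 : measurableType d1)
    (T2 : measurableType d2) (P1 : probability T1 R) (P2 : probability T2 R)
    (X : T2 -> R) : P2.-integrable setT (EFin \o X) ->
  (P1 \x P2)%E.-integrable setT (EFin \o (fun z => X z.2)).
Proof.
move=> iX.
have mX : measurable_fun setT X by apply/measurable_EFinP/(measurable_int _ iX).
apply/integrable21ltyP.
  by apply/measurable_EFinP; exact: measurableT_comp.
have /integrableP[_] := iX; apply: le_lt_trans.
rewrite le_eqVlt; apply/orP; left; apply/eqP; apply: eq_integral => x _ /=.
rewrite (integral_cst P1 measurableT `|X x|%:E).
by rewrite [X in (_ * X)%E](@probability_setT _ _ _ P1) mule1.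
Qed.

(** * Integration by parts for families of independent Gaussian variables *)

Section Resampling.
Context {R : realType} d d' (T : measurableType d) (T' : measurableType d').
Context (P : probability T R) (X : {RV P >-> R}) (Y : {RV P >-> T'}).
Hypothesis XY_indep : forall A B, measurable A -> measurable B ->
  P (X @^-1` A `&` Y @^-1` B) = (P (X @^-1` A) * P (Y @^-1` B))%E.

Let PX := distribution P X.
Let PY := distribution P Y.

(** By independence the law of [(X, Y)] is a product, and Fubini freezes [Y]. The value space of [Y]
    is arbitrary so that [Y] can stand for all the remaining disorder at once. *)
Lemma indep_resample (F : R * T' -> R) : measurable_fun setT F ->
  (PX \x PY)%E.-integrable setT (EFin \o F) ->
  (forall v, PX.-integrable setT (fun x => (F (x, v))%:E)) ->
  \int[P]_w F (X w, Y w) = \int[PY]_v \int[P]_w F (X w, v).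
Proof.
move=> mF iF iFv.
pose phi w := (X w, Y w).
have mphi : measurable_fun setT phi by apply: measurable_fun_pair.
have PP A : measurable A -> (PX \x PY)%E A = pushforward P phi A.
  move=> mA; apply: product_measure_unique => //.
have mEF : measurable_fun setT (EFin \o F) by exact/measurable_EFinP.
have iphi : P.-integrable setT (EFin \o F \o phi).
  apply/integrableP; split; first exact: measurableT_comp.
  have /integrableP[_] := iF; apply: le_lt_trans.
  have mab : measurable_fun setT (abse \o (EFin \o F)) by exact: measurableT_comp.
  have := @ge0_integral_pushforward _ _ _ _ _ _ mphi P setT _ measurableT mab.
  rewrite preimage_setT => <-//.
  rewrite le_eqVlt; apply/orP; left; apply/eqP.
  by apply: eq_measure_integral => A mA _; apply: esym; exact: PP.
  by move=> y _; exact: abse_ge0.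
transitivity (\int[(PX \x PY)%E]_z F z).
  rewrite /Rintegral; congr fine.
  have := integral_pushforward mphi mEF iphi measurableT.
  rewrite preimage_setT => <-.
  by apply: eq_measure_integral => A mA _; apply: esym; exact: PP.
rewrite Rfubini21//; apply: eq_Rintegral => v _.
rewrite /Rintegral; congr fine.
have mFv : measurable_fun setT (fun x => F (x, v)).
  by apply: measurableT_comp => //; exact: measurable_pair2.
rewrite integral_distribution//; first exact/measurable_EFinP.
have mX : measurable_fun setT (X : T -> R) by [].
have mFvE : measurable_fun setT (fun x => (F (x, v))%:E) by exact/measurable_EFinP.
apply/integrableP; split; first exact: (measurableT_comp mFvE).
have /integrableP[_] := iFv v; apply: le_lt_trans.
rewrite ge0_integral_distribution//.
exact: measurableT_comp.
Qed.

Lemma gaussian_ibp_indep (Phi dPhi : R -> T' -> R) (C : R) :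
  standard_gaussian X ->
  measurable_fun setT (fun z => Phi z.1 z.2) ->
  measurable_fun setT (fun z => dPhi z.1 z.2) ->
  (forall v (x : R), is_derive x (1:R) (Phi^~ v) (dPhi x v)) ->
  (forall v, continuous (dPhi^~ v)) ->
  (forall x v, `|Phi x v| <= C) -> (forall x v, `|dPhi x v| <= C) ->
  \int[P]_w (X w * Phi (X w) (Y w)) = \int[P]_w dPhi (X w) (Y w).
Proof.
move=> Xg mPhi mdPhi PhiE cdPhi PhiC dPhiC.
have iX : PX.-integrable setT (EFin \o id).
  have mX : measurable_fun setT (X : T -> R) by [].
  apply/integrableP; split; first exact/measurable_EFinP.
  have /integrableP[_] := integrable_standard_gaussian Xg; apply: le_lt_trans.
  rewrite ge0_integral_distribution//.
  by apply: measurableT_comp => //; exact/measurable_EFinP.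
rewrite (indep_resample (F := fun z => z.1 * Phi z.1 z.2)).
- rewrite (indep_resample (F := fun z => dPhi z.1 z.2))//.
  + apply: eq_Rintegral => v _ /=.
    exact: (gaussian_integration_by_parts Xg (PhiE v) (cdPhi v) (PhiC^~ v) (dPhiC^~ v)).
  + by apply: (@integrable_bounded _ _ _ _ _ C).
  + move=> v; apply: (@integrable_bounded _ _ _ _ (fun x => dPhi x v) C) => //.
    exact: continuous_measurable_fun.
- exact: measurable_funM.
- apply: (@integrableM_bounded _ _ _ (PX \x PY)%E (fun z => z.1) _ C) => //.
  exact: (@integrable_prod_fst _ _ _ _ _ PX PY id).
- move=> v; apply: (@integrableM_bounded _ _ _ PX id (Phi^~ v) C) => //.
  apply: continuous_measurable_fun => x.
  exact/differentiable_continuous/derivable1_diffP.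
Qed.

End Resampling.

Section GaussianSystem.
Context {R : realType} (I : finType).

Definition field {S : finType} (a : I -> S -> R) (b : S -> R) (x : I -> R) (s : S) : R :=
  \sum_i a i s * x i + b s.

(** Letting [S], [a] and [b] vary makes the property stable under the addition of a Gaussian
    variable: a frozen variable is absorbed into [b]. *)
Definition gaussian_ibp d (T : measurableType d) (P : probability T R)
    (x : I -> T -> R) :=
  forall (S : finType) (s0 : S) (a : I -> S -> R) (b : S -> R) n f k,
  depends n f ->
  \int[P]_w (x k w * avg s0 (gibbs (field a b (x^~ w))) n f) =
  \int[P]_w avg s0 (gibbs (field a b (x^~ w))) n.+1
    (fun sg => f sg * dreplica n (a k) sg).

Lemma measurable_field {S : finType} (a : I -> S -> R) b d (T : measurableType d)
    (x : I -> T -> R) s : (forall i, measurable_fun setT (x i)) ->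
  measurable_fun setT (fun w => field a b (x^~ w) s).
Proof.
move=> mx; apply: measurable_funD => //; apply: measurable_sum_fin => i.
exact: measurable_funM.
Qed.

Lemma is_derive_avg_field {S : finType} (s0 : S) (a : I -> S -> R) b
    (x : R -> I -> R) k n f (y : R) : depends n f ->
  (forall i, is_derive y (1:R) (x^~ i) (i == k)%:R) ->
  is_derive y (1:R) (fun y => avg s0 (gibbs (field a b (x y))) n f)
    (avg s0 (gibbs (field a b (x y))) n.+1 (fun sg => f sg * dreplica n (a k) sg)).
Proof.
move=> df dx; apply: (@is_derive_avg _ _ _ (fun y => field a b (x y))) => // s.
have -> : a k s = \sum_i a i s * (i == k)%:R + 0.
  rewrite addr0 (bigD1 k)//= eqxx mulr1 big1 ?addr0// => i /negbTE->.
  by rewrite mulr0.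
apply: is_deriveD; apply: is_derive_bigsum => i.
Qed.

Lemma continuous_derive_field {S : finType} (s0 : S) (a : I -> S -> R) b
    (x : R -> I -> R) k n f : depends n f ->
  (forall y i, is_derive y (1:R) (x^~ i) (i == k)%:R) ->
  continuous (fun y => avg s0 (gibbs (field a b (x y))) n f).
Proof.
move=> df dx y; apply/differentiable_continuous/derivable1_diffP.
have := is_derive_avg_field s0 a b df (dx y).
by case.
Qed.

End GaussianSystem.

Section IndependentIBP.
Context {R : realType} d (T : measurableType d) (P : probability T R).
Context (I : finType) (g : I -> {RV P >-> R}).
Hypothesis g_gauss : forall i, standard_gaussian (g i).
Hypothesis g_indep : mutually_independent g.
Variable k : I.

Let G : set (set T) := [set A | exists (J : {set I}) (B : I -> set R),
  [/\ k \notin J, (forall i, measurable (B i)) &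
      A = \bigcap_(i in [set` J]) (g i @^-1` B i)]].

Let mg i : measurable_fun setT (g i : T -> R). Proof. by []. Qed.

Let mgB i (B : set R) : measurable B -> measurable (g i @^-1` B).
Proof. by move=> mB; rewrite -[X in measurable X]setTI; exact: mg. Qed.

Let G_measurable : G `<=` measurable.
Proof.
move=> _ [J [B [_ mB ->]]]; apply: fin_bigcap_measurable => // i _; exact: mgB.
Qed.

Let G_setI : setI_closed G.
Proof.
move=> _ _ [J [B [kJ mB ->]]] [J' [B' [kJ' mB' ->]]].
exists (J :|: J'), (fun i => (if i \in J then B i else setT) `&`
  (if i \in J' then B' i else setT)); split.
- by rewrite inE negb_or kJ.
- by move=> i; apply: measurableI; case: ifP.
- apply/seteqP; split=> [w [wB wB'] i iJ|w wBB]; [|split].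
  + split; case: ifPn => // ? ; [exact: wB|exact: wB'].
  + move=> i iJ; have : [set` J :|: J'] i by rewrite /= inE iJ.
    by move=> /wBB[]; rewrite (_ : i \in J).
  + move=> i iJ; have : [set` J :|: J'] i by rewrite /= inE iJ orbT.
    by move=> /wBB[_]; rewrite (_ : i \in J').
Qed.

Let GT : G setT.
Proof.
exists finset.set0, (fun=> setT); split=> //; first by rewrite inE.
by apply/seteqP; split=> // w _ i; rewrite /= inE.
Qed.

(** For fixed [A] both sides are finite measures in [E]. They agree on the pi-system [G], hence on
    the sigma-algebra it generates. *)
Let indep_sigma (A : set R) (E : set T) : measurable A -> <<s G >> E ->
  P (E `&` g k @^-1` A) = (P (g k @^-1` A) * P E)%E.
Proof.
move=> mA GE; have mD := mgB k mA.
have pD : P (g k @^-1` A) \is a fin_num by exact: fin_num_measure.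
have p0 : 0 <= fine (P (g k @^-1` A)) by exact: fine_ge0.
transitivity (mscale (NngNum p0) P E); last by rewrite /mscale/= fineK.
transitivity (mrestr P mD E) => //.
apply: (@g_sigma_algebra_measure_unique _ _ _ G G_measurable (fun=> setT)) => //.
- by apply/seteqP; split=> // w _; exists 0%N.
- move=> _ [J [B [kJ mB ->]]]; rewrite /= /mrestr /mscale/= fineK//.
  (* As [k] is not in [J], the event on [g k] can be inserted as one more factor of the independence
     formula. *)
  pose B' i := if i == k then A else B i.
  have mB' i : measurable (B' i) by rewrite /B'; case: ifP.
  have JB : \bigcap_(i in [set` J]) (g i @^-1` B i) =
      \bigcap_(i in [set` J]) (g i @^-1` B' i).
    apply: eq_bigcapr => i /= iJ; rewrite /B' ifN//.
    by apply: contraNneq kJ => <-.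
  have kJB : \bigcap_(i in [set` J]) (g i @^-1` B i) `&` g k @^-1` A =
      \bigcap_(i in [set` k |: J]) (g i @^-1` B' i).
    rewrite JB; apply/seteqP; split=> [w [wJ wk] i /=|w wkJ].
      by rewrite !inE => /orP[/eqP->|/wJ//]; rewrite /B' eqxx.
    split=> [i iJ|]; first by apply: wkJ; rewrite /= !inE iJ orbT.
    by have := wkJ k; rewrite /= !inE eqxx /B' eqxx; apply.
  rewrite kJB JB !g_indep// big_setU1//=; congr (_ * _)%E.
  by rewrite /B' eqxx.
- by move=> n /=; rewrite /mrestr setTI ltey_eq fin_num_measure.
Qed.

(** The same space with the smaller sigma-algebra: the identity into it is a random variable
    carrying all the disorder except [g k]. *)
Let Tk := g_sigma_algebraType G.
Let toTk : T -> Tk := id.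

Let m_toTk : measurable_fun setT toTk.
Proof.
move=> _ E mE; rewrite setTI /toTk preimage_id.
by apply: smallest_sub mE; [exact: sigma_algebra_measurable|exact: G_measurable].
Qed.

Let m_other i : i != k -> measurable_fun setT (g i : Tk -> R).
Proof.
move=> ik _ B mB; rewrite setTI; apply: sub_sigma_algebra.
exists [set i]%SET, (fun=> B); split=> //; first by rewrite inE eq_sym.
apply/seteqP; split=> [w wB j /=|w]; first by rewrite inE => /eqP->.
by apply; rewrite /= inE.
Qed.

Lemma gaussian_ibp_coordinate (S : finType) (s0 : S) (a : I -> S -> R) (b : S -> R) n f :
  depends n f ->
  \int[P]_w (g k w * avg s0 (gibbs (field a b (g^~ w))) n f) =
  \int[P]_w avg s0 (gibbs (field a b (g^~ w))) n.+1
    (fun sg => f sg * dreplica n (a k) sg).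
Proof.
move=> df.
pose Y : {RV P >-> Tk} := mfun_Sub (mem_set m_toTk).
have XY A B : measurable A -> measurable B ->
    P (g k @^-1` A `&` Y @^-1` B) = (P (g k @^-1` A) * P (Y @^-1` B))%E.
  by move=> mA mB; rewrite setIC; exact: indep_sigma.
(* [g k] need not be measurable on [Tk]; overwriting it by [y] leaves only variables that are, and
   [xE] recovers the disorder. *)
pose x (y : R) (v : Tk) (i : I) := if i == k then y else g i v.
pose Phi m h (y : R) (v : Tk) := avg s0 (gibbs (field a b (x y v))) m h.
have xE w : x (g k w) w = g^~ w.
  by apply/funext => i; rewrite /x; case: eqP => // ->.
have mPhi m h : measurable_fun setT (fun z : R * Tk => Phi m h z.1 z.2).
  apply: measurable_avg => s; apply: measurable_gibbs => // {}s.
  apply: (@measurable_field _ _ _ _ _ _ _ (fun i (z : R * Tk) => x z.1 z.2 i)) => i.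
  rewrite /x; case: eqVneq => [_|ik]; first exact: measurable_fst.
  exact: (measurableT_comp (m_other ik)).
have dx v (y : R) i : is_derive y (1:R) (fun y => x y v i) (i == k)%:R.
  rewrite /x; case: eqP => _; first exact: is_derive_id.
  exact: is_derive_cst.
pose df1 := dependsM (depends_le (leqnSn n) df) (dependsD (n := n) (a k)).
have [C1 C1P] := depends_bounded df.
have [C2 C2P] := depends_bounded df1.
have := gaussian_ibp_indep (Y := Y) XY (C := Num.max C1 C2) (g_gauss k)
  (mPhi n f) (mPhi n.+1 _)
  (fun v y => is_derive_avg_field s0 a b df (dx v y))
  (fun v => continuous_derive_field df1 (dx v)).
rewrite /Phi.
under eq_Rintegral do rewrite xE.
under [in RHS]eq_Rintegral do rewrite xE.
apply=> y v; rewrite le_max; apply/orP; [left|right];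
  apply: avg_bound => //; [exact: gibbs_ge0|exact: gibbs_sum1|
  exact: gibbs_ge0|exact: gibbs_sum1].
Qed.

End IndependentIBP.

Lemma gaussian_ibp_indep_family {R : realType} d (T : measurableType d)
    (P : probability T R) (I : finType) (g : I -> {RV P >-> R}) :
  (forall i, standard_gaussian (g i)) -> mutually_independent g ->
  gaussian_ibp P g.
Proof. by move=> gg gi S s0 a b n f k df; exact: gaussian_ibp_coordinate. Qed.

Lemma sum_option {V : nmodType} (I : finType) (F : option I -> V) :
  \sum_o F o = F None + \sum_i F (Some i).
Proof.
rewrite (bigD1 None)//=; congr (_ + _).
rewrite (reindex_omap Some id) => [|[]//]; apply: eq_bigl => i.
by rewrite eqxx.
Qed.

Section ProductSystem.
Context {R : realType} d1 d2 (T1 : measurableType d1) (T2 : measurableType d2).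
Variables (P1 : probability T1 R) (P2 : probability T2 R).
Context (I : finType) (x : I -> T1 -> R) (Z : {RV P2 >-> R}).
Hypothesis ix : forall i, P1.-integrable setT (EFin \o x i).
Hypothesis x_ibp : gaussian_ibp P1 x.
Hypothesis Z_gauss : standard_gaussian Z.

Definition add_variable (o : option I) (w : T1 * T2) : R :=
  if o is Some i then x i w.1 else Z w.2.

Lemma integrable_add_variable o :
  (P1 \x P2)%E.-integrable setT (EFin \o add_variable o).
Proof.
case: o => [i|]; first exact: (integrable_prod_fst P2 (ix i)).
exact: (integrable_prod_snd P1 (integrable_standard_gaussian Z_gauss)).
Qed.

Let mx i : measurable_fun setT (x i).
Proof. by apply/measurable_EFinP/(measurable_int _ (ix i)). Qed.

Lemma gaussian_ibp_add_variable : gaussian_ibp (P1 \x P2)%E add_variable.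
Proof.
move=> S s0 a b n f k df.
have df1 := dependsM (depends_le (leqnSn n) df) (dependsD (n := n) (a k)).
have [C1 C1P] := depends_bounded df.
have [C2 C2P] := depends_bounded df1.
pose A m h (w : T1 * T2) := avg s0 (gibbs (field a b (add_variable^~ w))) m h.
have mZ : measurable_fun setT (Z : T2 -> R) by [].
have mo o : measurable_fun setT (add_variable o).
  by case: o => [i|]; apply: measurableT_comp.
have mA m h : measurable_fun setT (A m h).
  apply: measurable_avg => s; apply: measurable_gibbs => // {}s.
  exact: measurable_field.
have A1 w : `|A n f w| <= C1.
  by apply: avg_bound => //; [exact: gibbs_ge0|exact: gibbs_sum1].
have A2 w : `|A n.+1 (fun sg => f sg * dreplica n (a k) sg) w| <= C2.
  by apply: avg_bound => //; [exact: gibbs_ge0|exact: gibbs_sum1].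
have iL := integrableM_bounded (integrable_add_variable k) (mA n f) A1.
have iR := integrable_bounded (P1 \x P2)%E (mA n.+1 _) A2.
have mA1 m h y : measurable_fun setT (fun w1 => A m h (w1, y)).
  by apply: measurableT_comp => //; exact: measurable_pair2.
have mA2 m h y : measurable_fun setT (fun w2 => A m h (y, w2)).
  by apply: measurableT_comp => //; exact: measurable_pair1.
case: k df1 C2P A2 iL iR => [i|] df1 C2P A2 iL iR.
- rewrite Rfubini21//; last first.
    by move=> y; apply: (@integrableM_bounded _ _ _ _ (x i) (fun w => A n f (w, y)) C1).
  rewrite [RHS]Rfubini21//; last first.
    by move=> y; apply: (@integrable_bounded _ _ _ _ (fun w => A n.+1 _ (w, y)) C2).
  apply: eq_Rintegral => y _.
  pose a' i s := a (Some i) s.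
  pose b' s := a None s * Z y + b s.
  have fE w : field a b (add_variable^~ (w, y)) = field a' b' (x^~ w).
    apply/funext => s; rewrite /field sum_option/= addrAC addrC addrA.
    by rewrite addrC addrA.
  under eq_Rintegral do rewrite fE.
  under [RHS]eq_Rintegral do rewrite fE.
  exact: x_ibp.
- rewrite Rfubini12//; last first.
    move=> w; apply: (@integrableM_bounded _ _ _ _ Z (fun y => A n f (w, y)) C1) => //.
    exact: integrable_standard_gaussian.
  rewrite [RHS]Rfubini12//; last first.
    by move=> w; apply: (@integrable_bounded _ _ _ _ (fun y => A n.+1 _ (w, y)) C2).
  apply: eq_Rintegral => w _.
  pose X (y : R) (o : option I) : R := if o is Some i then x i w else y.
  have XE y : X (Z y) = add_variable^~ (w, y) by apply/funext; case.
  have dx (y : R) o : is_derive y (1:R) (X^~ o) (o == None)%:R.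
    by case: o => [i|]; [exact: is_derive_cst|exact: is_derive_id].
  have := gaussian_integration_by_parts (C := Num.max C1 C2) Z_gauss
    (fun y => is_derive_avg_field s0 a b df (dx y))
    (continuous_derive_field df1 dx).
  under eq_Rintegral do rewrite XE.
  under [in RHS]eq_Rintegral do rewrite XE.
  apply=> y; rewrite le_max; apply/orP; [left|right];
    apply: avg_bound => //; [exact: gibbs_ge0|exact: gibbs_sum1|
    exact: gibbs_ge0|exact: gibbs_sum1].
Qed.

End ProductSystem.

(** * Differential inequalities between 0 and pi / 2 *)

Lemma ge0_is_derive_le {R : realType} (F dF : R -> R) (a b : R) :
  (forall x : R, is_derive x (1:R) F (dF x)) ->
  (forall x, a <= x <= b -> 0 <= dF x) -> a <= b -> F a <= F b.
Proof.
move=> FE dF0 ab.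
have cF : {within `[a, b], continuous F}.
  apply: continuous_subspaceT => x.
  exact/differentiable_continuous/derivable1_diffP.
have [c cab cE] := MVT_segment ab (fun x _ => FE x) cF.
rewrite -subr_ge0 cE mulr_ge0 ?subr_ge0// dF0//.
Qed.

Lemma is_derive_sin_sqr {R : realType} (x : R) :
  is_derive x (1:R) (fun y : R => sin y ^+ 2) (2 * (sin x * cos x)).
Proof. by apply: is_derive_eq; rewrite /GRing.scale/=; ring. Qed.

Section HalfPi.
Context {R : realType}.

Lemma sincos_ge0 (x : R) : 0 <= x <= pi / 2 -> 0 <= sin x * cos x.
Proof.
move=> /andP[x0 xpi]; have pi0 := pi_ge0 R; rewrite mulr_ge0//.
  by rewrite sin_ge0_pi// x0/= (le_trans xpi)// ler_pdivrMr// ler_peMr// ler1n.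
by rewrite cos_ge0_pihalf// xpi andbT (le_trans _ x0)// oppr_le0 divr_ge0.
Qed.

(** The factor [1 / 2] is the integral of [sin * cos] from [0] to [pi / 2]. *)
Lemma sincos_derive_dist (F psi : R -> R) (B x y : R) :
  (forall x : R, is_derive x (1:R) F (sin x * cos x * psi x)) ->
  (forall x, 0 <= x <= pi / 2 -> `|psi x| <= B) ->
  0 <= x -> x <= y -> y <= pi / 2 -> `|F y - F x| <= B / 2.
Proof.
move=> FE psiB x0 xy ypi.
have B0 : 0 <= B.
  by apply: (le_trans (normr_ge0 _) (psiB x _)); rewrite x0 (le_trans xy).
have s1 (z : R) : 0 <= sin z ^+ 2 <= 1.
  by rewrite sqr_ge0 -(cos2Dsin2 z) lerDr sqr_ge0.
have step (e : R) : `|e| = 1 -> e * (F y - F x) <= B / 2.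
  move=> e1.
  (* [B / 2 * sin ^+ 2 - e * F] is nondecreasing on [0, pi / 2] *)
  have D (z : R) : is_derive z (1:R) (fun z => B / 2 * sin z ^+ 2 - e * F z)
      (sin z * cos z * (B - e * psi z)).
    have h1 := is_deriveM (is_derive_cst (B / 2) z (1:R)) (is_derive_sin_sqr z).
    have h2 := is_deriveM (is_derive_cst e z (1:R)) (FE z).
    apply: is_derive_eq (is_deriveB h1 h2) _.
    by rewrite /GRing.scale/= /cst; field.
  have := ge0_is_derive_le D _ xy.
  have /[swap]/[apply] : forall z, x <= z <= y -> 0 <= sin z * cos z * (B - e * psi z).
    move=> z /andP[xz zy].
    have zpi : 0 <= z <= pi / 2 by rewrite (le_trans x0)//= (le_trans zy).
    rewrite mulr_ge0 ?sincos_ge0// subr_ge0 (le_trans (ler_norm _))//.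
    by rewrite normrM e1 mul1r psiB.
  have := s1 x; have := s1 y; nra.
rewrite ler_norml; apply/andP; split.
  by have := step (-1); rewrite normrN1 => /(_ erefl); lra.
by have := step 1; rewrite normr1 => /(_ erefl); lra.
Qed.

(** Gronwall run backwards: the control is by the value at [pi / 2], the end that carries the true
    Gibbs measure. *)
Lemma sincos_gronwall (F psi : R -> R) (c x : R) :
  (forall x : R, is_derive x (1:R) F (sin x * cos x * psi x)) ->
  (forall x, 0 <= F x) -> 0 <= c ->
  (forall x, 0 <= x <= pi / 2 -> `|psi x| <= c * F x) ->
  0 <= x <= pi / 2 -> F x <= expR (c / 2) * F (pi / 2).
Proof.
move=> FE F0 c0 psiF /andP[x0 xpi].
(* [K * F] is nondecreasing on [0, pi / 2] *)
pose K (z : R) := expR (c / 2 * sin z ^+ 2).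
have KE (z : R) : is_derive z (1:R) K (K z * (c * (sin z * cos z))).
  have h1 := is_deriveM (is_derive_cst (c / 2) z (1:R)) (is_derive_sin_sqr z).
  have := is_derive1_comp (is_derive_expR _) h1.
  by move=> /is_derive_eq; apply; rewrite /K /GRing.scale/= /cst; field.
have D (z : R) := is_deriveM (KE z) (FE z).
have := ge0_is_derive_le D _ xpi.
have /[swap]/[apply] : forall z, x <= z <= pi / 2 ->
    0 <= K z *: (sin z * cos z * psi z) + F z *: (K z * (c * (sin z * cos z))).
  move=> z /andP[xz zpi].
  have zz : 0 <= z <= pi / 2 by rewrite (le_trans x0).
  rewrite (_ : _ + _ = K z * (sin z * cos z) * (psi z + c * F z)); last first.
    by rewrite /GRing.scale/=; ring.
  apply: mulr_ge0; first by apply: mulr_ge0; [exact: expR_ge0|exact: sincos_ge0].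
  by have := psiF _ zz; rewrite ler_norml => /andP[]; lra.
change (K x * F x <= K (pi / 2) * F (pi / 2) -> F x <= expR (c / 2) * F (pi / 2)).
rewrite /K sin_pihalf expr1n mulr1; apply: le_trans.
rewrite ler_peMl// -expR0 ler_expR mulr_ge0 ?divr_ge0 ?sqr_ge0//.
Qed.

End HalfPi.

(** * Interpolation between two Gaussian fields *)

Section Interpolation.
Context {R : realType} d (T : measurableType d) (P : probability T R).
Context (I S : finType) (s0 : S) (x : I -> T -> R).
Hypothesis ix : forall i, P.-integrable setT (EFin \o x i).
Hypothesis x_ibp : gaussian_ibp P x.
Variables (u v r : I -> S -> R) (b : S -> R).
Hypothesis uv0 : forall i s t, u i s * v i t = 0.
Hypothesis ur0 : forall i s t, u i s * r i t = 0.
Hypothesis vr0 : forall i s t, v i s * r i t = 0.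

(* With [sin th] and [cos th] instead of the usual [sqrt t] and [sqrt (1 - t)],
   the path is smooth up to both ends. *)
Definition path_coef (th : R) i s := sin th * u i s + cos th * v i s + r i s.

Definition path_gibbs (th : R) (w : T) := gibbs (field (path_coef th) b (x^~ w)).

Definition nu_path (th : R) n (f : (nat -> S) -> R) : R :=
  \int[P]_w avg s0 (path_gibbs th w) n f.

Definition path_cov s t : R := \sum_i (u i s * u i t - v i s * v i t).

Let mx i : measurable_fun setT (x i).
Proof. by apply/measurable_EFinP/(measurable_int _ (ix i)). Qed.

Let G0 th w s : 0 <= path_gibbs th w s. Proof. exact: gibbs_ge0. Qed.
Let G1 th w : \sum_s path_gibbs th w s = 1. Proof. exact: gibbs_sum1. Qed.

Lemma measurable_path_avg th n f :
  measurable_fun setT (fun w => avg s0 (path_gibbs th w) n f).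
Proof.
apply: measurable_avg => s; apply: measurable_gibbs => // {}s.
exact: measurable_field.
Qed.

Lemma integrable_path_avg th n f :
  P.-integrable setT (EFin \o (fun w => avg s0 (path_gibbs th w) n f)).
Proof.
have [C CP] := avg_le1_bounded s0 n f.
apply: (@integrable_bounded _ _ _ _ _ C); first exact: measurable_path_avg.
by move=> w; exact: CP.
Qed.

Let ipa := integrable_path_avg.

Lemma nu_pathD th n f g :
  nu_path th n (fun sg => f sg + g sg) = nu_path th n f + nu_path th n g.
Proof. by rewrite /nu_path; under eq_Rintegral do rewrite avgD; rewrite RintegralD. Qed.

Lemma nu_pathB th n f g :
  nu_path th n (fun sg => f sg - g sg) = nu_path th n f - nu_path th n g.
Proof. by rewrite /nu_path; under eq_Rintegral do rewrite avgB; rewrite RintegralB. Qed.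

Lemma nu_pathZ th n c f :
  nu_path th n (fun sg => c * f sg) = c * nu_path th n f.
Proof. by rewrite /nu_path; under eq_Rintegral do rewrite avgZ; rewrite RintegralZl. Qed.

Lemma nu_path_sum th n (J : Type) (rJ : seq J) (Q : pred J) (F : J -> (nat -> S) -> R) :
  nu_path th n (fun sg => \sum_(j <- rJ | Q j) F j sg) =
  \sum_(j <- rJ | Q j) nu_path th n (F j).
Proof.
elim: rJ => [|j rJ IH].
  rewrite big_nil (_ : (fun sg => _) = (fun sg => 0 * 0)); last first.
    by apply/funext => sg; rewrite big_nil mul0r.
  by rewrite (nu_pathZ th n 0 (fun=> 0)) mul0r.
rewrite big_cons -IH; case: ifP => Qj.
  rewrite -nu_pathD; congr nu_path; apply/funext => sg.
  by rewrite big_cons Qj.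
by congr nu_path; apply/funext => sg; rewrite big_cons Qj.
Qed.

Lemma nu_path_cst th n c : nu_path th n (fun=> c) = c.
Proof.
rewrite /nu_path; under eq_Rintegral do rewrite avg_cst//.
by rewrite (Rintegral_cst P measurableT c) [X in fine X](probability_setT P) mulr1.
Qed.

Lemma ler_nu_path th n f g : (forall sg, f sg <= g sg) ->
  nu_path th n f <= nu_path th n g.
Proof. by move=> fg; apply: le_Rintegral => // w _; exact: ler_avg. Qed.

Lemma nu_path_ge0 th n f : (forall sg, 0 <= f sg) -> 0 <= nu_path th n f.
Proof. by move=> f0; rewrite -(nu_path_cst th n 0); exact: ler_nu_path. Qed.

Lemma ler_norm_nu_path th n f : `|nu_path th n f| <= nu_path th n (fun sg => `|f sg|).
Proof.
rewrite ler_norml; apply/andP; split; last by apply: ler_nu_path => sg; exact: ler_norm.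
rewrite -mulN1r -nu_pathZ; apply: ler_nu_path => sg.
by rewrite mulN1r lerNl -normrN ler_norm.
Qed.

Lemma nu_path_marg2 th n l m (a : S -> S -> R) : (l < n)%N -> (m < n)%N -> l != m ->
  nu_path th n (fun sg => a (sg l) (sg m)) =
  nu_path th 2 (fun sg => a (sg 0%N) (sg 1%N)).
Proof. by move=> ln mn lm; apply: eq_Rintegral => w _; exact: avg_marg2. Qed.

Definition nu_path_deriv (th : R) n f : R := nu_path th n.+2 (fun sg => f sg *
  \sum_(l < n.+1) \sum_(m < n.+2)
    dcoef n l * dcoef n.+1 m * path_cov (sg l) (sg m)).

Let dpath (th : R) i s := cos th * u i s - sin th * v i s.

Let is_derive_path (th : R) w s : is_derive th (1:R)
  (fun y => field (path_coef y) b (x^~ w) s) (\sum_i dpath th i s * x i w).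
Proof.
rewrite -[X in is_derive _ _ _ X]addr0.
apply: is_deriveD; apply: is_derive_bigsum => i.
have D : is_derive th (1:R) (fun y => path_coef y i s) (dpath th i s).
  by apply: is_derive_eq; rewrite /GRing.scale/= /dpath; ring.
apply: is_derive_eq (is_deriveM D (is_derive_cst (x i w) th (1:R))) _.
by rewrite /GRing.scale/= /cst; ring.
Qed.

Let dpath_bound th i s : `|dpath th i s| <= `|u i s| + `|v i s|.
Proof.
rewrite (le_trans (ler_normB _ _))// !normrM lerD// ler_piMl//.
- by rewrite ler_norml cos_geN1 cos_le1.
- by rewrite ler_norml sin_geN1 sin_le1.
Qed.

(** Differentiating brings in one replica and a factor linear in the disorder; integrating that
    factor by parts brings in another one, hence [n.+2] replicas. *)
Lemma is_derive_nu_path th n f : depends n f ->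
  is_derive th (1:R) (fun y => nu_path y n f) (sin th * cos th * nu_path_deriv th n f).
Proof.
move=> df.
have [C CP] := depends_bounded df.
have C0 : 0 <= C := le_trans (normr_ge0 _) (CP (fun=> s0)).
pose F (y : R) w := avg s0 (path_gibbs y w) n f.
pose dF (y : R) w := avg s0 (path_gibbs y w) n.+1
  (fun sg => f sg * dreplica n (fun s => \sum_i dpath y i s * x i w) sg).
have FE (y : R) w : is_derive y (1:R) (F^~ w) (dF y w).
  exact: (@is_derive_avg _ _ s0 (fun y => field (path_coef y) b (x^~ w))).
pose M i := \sum_s (`|u i s| + `|v i s|).
(* Since [sin] and [cos] are bounded by [1], this dominates the derivative for all [y]; being linear
   in the [|x i|], it is integrable. *)
pose Gb w := C * (n%:R *+ 2 * \sum_i M i * `|x i w|).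
have dFb y w : `|dF y w| <= Gb w.
  apply: avg_bound => // sg; rewrite normrM ler_pM//.
  apply: dreplica_bound => s; rewrite (le_trans (ler_norm_sum _ _ _))//.
  apply: ler_sum => i _; rewrite normrM ler_wpM2r// (le_trans (dpath_bound _ _ _))//.
  by rewrite /M (bigD1 s)//= lerDl sumr_ge0// => t _; rewrite addr_ge0.
have iG : P.-integrable setT (EFin \o Gb).
  rewrite (_ : _ \o _ = (fun w => C%:E * ((n%:R *+ 2)%:E *
    (\sum_i M i * `|x i w|)%:E))%E)//.
  apply: integrableZl => //; apply: integrableZl => //.
  apply: integrable_bigsum => i.
  rewrite (_ : _ \o _ = (fun w => (M i)%:E * `|(x i w)%:E|)%E)//.
  apply: integrableZl => //; exact: integrable_abse (ix i).
have G0' w : 0 <= Gb w.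
  by rewrite (le_trans _ (dFb th w)).
have Ia : `]th - 1, th + 1[%classic th.
  by rewrite /= in_itv/= ltrBlDr ltrDl ltr01/=.
have intF y : `]th - 1, th + 1[%classic y -> P.-integrable setT (EFin \o F y).
  by move=> _; exact: ipa.
have derF y w : `]th - 1, th + 1[%classic y -> setT w -> derivable (F^~ w) y 1.
  by move=> _ _; case: (FE y w).
have dFE y w : partial1of2 F y w = dF y w.
  by rewrite partial1of2E; case: (FE y w).
have Gub y w : `]th - 1, th + 1[%classic y -> setT w -> `|partial1of2 F y w| <= Gb w.
  by rewrite dFE.
have D1 := derivable_under_integral measurableT Ia intF derF G0' iG Gub.
have D2 := differentiation_under_integral measurableT Ia intF derF G0' iG Gub.
apply: DeriveDef; first exact: D1.
rewrite -derive1E [LHS]D2.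
under eq_Rintegral do rewrite dFE.
pose fi i sg := f sg * dreplica n (dpath th i) sg.
have dfi i : depends n.+1 (fi i).
  exact: dependsM (depends_le (leqnSn n) df) (dependsD _).
transitivity (\int[P]_w \sum_i x i w * avg s0 (path_gibbs th w) n.+1 (fi i)).
  apply: eq_Rintegral => w _; rewrite /dF.
  under eq_bigr do rewrite -avgZ.
  rewrite -avg_sum; congr avg; apply/funext => sg.
  rewrite /fi /dreplica.
  under [RHS]eq_bigr do rewrite mulrCA mulr_sumr.
  rewrite -mulr_sumr exchange_big/=; congr (_ * _).
  apply: eq_bigr => l _; rewrite mulr_sumr; apply: eq_bigr => i _.
  by ring.
transitivity (\sum_i \int[P]_w (x i w * avg s0 (path_gibbs th w) n.+1 (fi i))).
  apply: Rintegral_bigsum => i.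
  have [Ci CiP] := avg_le1_bounded s0 n.+1 (fi i).
  apply: (@integrableM_bounded _ _ _ _ _ _ Ci (ix i)).
    exact: measurable_path_avg.
  by move=> w; exact: CiP.
under eq_bigr do rewrite x_ibp//.
transitivity (\sum_i nu_path th n.+2
    (fun sg => fi i sg * dreplica n.+1 (path_coef th i) sg)) => //.
rewrite -nu_path_sum /nu_path_deriv -nu_pathZ; congr nu_path; apply/funext => sg.
rewrite /fi; under eq_bigr do rewrite -mulrA.
rewrite -mulr_sumr mulrCA; congr (_ * _).
rewrite /dreplica.
under eq_bigr do rewrite big_distrlr/=.
rewrite exchange_big/= mulr_sumr; apply: eq_bigr => l _.
rewrite exchange_big/= mulr_sumr; apply: eq_bigr => m _.
rewrite /path_cov !mulr_sumr; apply: eq_bigr => i _.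
rewrite /dpath /path_coef.
(* Each Gaussian variable enters only one of the three fields, so all mixed products vanish and
   [sin th * cos th] factors out of what is left. *)
have := uv0 i (sg l) (sg m); have := uv0 i (sg m) (sg l).
have := ur0 i (sg l) (sg m); have := vr0 i (sg l) (sg m).
set ul := u i (sg l); set vl := v i (sg l); set um := u i (sg m).
set vm := v i (sg m); set rm := r i (sg m) => e1 e2 e3 e4.
have -> : dcoef n l * (cos th * ul - sin th * vl) *
  (dcoef n.+1 m * (sin th * um + cos th * vm + rm)) =
  dcoef n l * dcoef n.+1 m * (sin th * cos th * (ul * um - vl * vm)
   + cos th * cos th * (ul * vm) - sin th * sin th * (um * vl)
   + cos th * (ul * rm) - sin th * (vl * rm)) by ring.
by rewrite e1 e2 e3 e4; ring.
Qed.

Lemma sum_dcoef_norm n : \sum_(l < n.+1) `|dcoef n l| = n%:R *+ 2 :> R.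
Proof.
rewrite big_ord_recr/= {2}/dcoef eqxx normrN ger0_norm// mulr2n; congr (_ + _).
rewrite (eq_bigr (fun=> 1)); last by move=> l _; rewrite /dcoef ltn_eqF// normr1.
by rewrite sumr_const card_ord.
Qed.

(* The coefficients [dcoef n l], [l <= n], sum to zero. *)
Lemma nu_path_deriv_offdiag (c : R) th n f : (forall s, path_cov s s = c) ->
  nu_path_deriv th n f = \sum_(l < n.+1) \sum_(m < n.+2 | m != l :> nat)
    dcoef n l * dcoef n.+1 m *
      nu_path th n.+2 (fun sg => f sg * path_cov (sg l) (sg m)).
Proof.
move=> diag; rewrite /nu_path_deriv.
transitivity (nu_path th n.+2 (fun sg => \sum_(l < n.+1) \sum_(m < n.+2 | m != l :> nat)
    dcoef n l * dcoef n.+1 m * (f sg * path_cov (sg l) (sg m)))); last first.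
  rewrite nu_path_sum; apply: eq_bigr => l _.
  rewrite nu_path_sum; apply: eq_bigr => m _.
  by rewrite nu_pathZ.
congr nu_path; apply/funext => sg.
under [RHS]eq_bigr do under eq_bigr do rewrite mulrCA.
under [RHS]eq_bigr do rewrite -mulr_sumr.
rewrite -mulr_sumr; congr (_ * _).
rewrite (eq_bigr (fun l : 'I_n.+1 => dcoef n l * c + \sum_(m < n.+2 | m != l :> nat)
    dcoef n l * dcoef n.+1 m * path_cov (sg l) (sg m))); last first.
  move=> l _; rewrite (bigD1 (widen_ord (leqnSn _) l))//=; congr (_ + _).
    by rewrite diag /dcoef (ltn_eqF (ltn_ord l)) mulr1.
rewrite big_split/= -mulr_suml big_ord_recr/= (eq_bigr (fun=> 1)); last first.
  by move=> l _; rewrite /dcoef ltn_eqF.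
by rewrite sumr_const card_ord /dcoef eqxx subrr mul0r add0r.
Qed.

(** The two families of coefficients have total absolute mass [2 * n] and [2 * n.+1]. A covariance
    that is constant on the diagonal makes coinciding replicas cancel, so only distinct ones are to
    be bounded. *)
Lemma nu_path_deriv_bound (c : R) th n f B : (forall s, path_cov s s = c) -> 0 <= B ->
  (forall l m, (l < n.+1)%N -> (m < n.+2)%N -> l != m ->
    `|nu_path th n.+2 (fun sg => f sg * path_cov (sg l) (sg m))| <= B) ->
  `|nu_path_deriv th n f| <= 4 * n%:R * n.+1%:R * B.
Proof.
move=> diag B0 fB; rewrite (nu_path_deriv_offdiag _ _ _ diag).
rewrite (le_trans (ler_norm_sum _ _ _))//.
apply: (@le_trans _ _ (\sum_(l < n.+1) \sum_(m < n.+2)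
    `|dcoef n l| * (`|dcoef n.+1 m| * B))).
  apply: ler_sum => l _; rewrite (le_trans (ler_norm_sum _ _ _))//.
  rewrite [leLHS]big_mkcond/=; apply: ler_sum => m _; case: ifPn => ml.
    by rewrite !normrM mulrA ler_wpM2l ?mulr_ge0// fB// eq_sym.
  by rewrite !mulr_ge0.
under eq_bigr do rewrite -mulr_sumr -mulr_suml sum_dcoef_norm.
rewrite -mulr_suml sum_dcoef_norm -[n%:R *+ 2]mulr_natr -[n.+1%:R *+ 2]mulr_natr.
by rewrite le_eqVlt; apply/orP; left; apply/eqP; ring.
Qed.

End Interpolation.

(** * Powers, elementary symmetric polynomials and the p-spin covariance *)

Lemma half_pred_sqr_le (R : realFieldType) (p : nat) :
  p%:R / 2 * p.-1%:R ^+ 2 <= p%:R ^+ 3 :> R.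
Proof.
have p1p : p.-1%:R ^+ 2 <= p%:R ^+ 2 :> R by rewrite lerXn2r ?nnegrE// ler_nat leq_pred.
have p0 : 0 <= p%:R :> R by [].
have pp : 0 <= p%:R ^+ 2 :> R by exact: sqr_ge0.
rewrite exprS; nra.
Qed.

Section PowerBounds.
Context {R : realType}.
Implicit Types (a q : R) (m : nat).

Lemma norm_expr_le1 a m : `|a| <= 1 -> `|a ^+ m| <= 1.
Proof. by move=> a1; rewrite normrX exprn_ile1. Qed.

Lemma subrX_bound a q m : `|a| <= 1 -> `|q| <= 1 ->
  `|a ^+ m - q ^+ m| <= m%:R * `|a - q|.
Proof.
move=> a1 q1; elim: m => [|m IH]; first by rewrite !expr0 subrr normr0 mul0r.
have -> : a ^+ m.+1 - q ^+ m.+1 = a * (a ^+ m - q ^+ m) + (a - q) * q ^+ m.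
  by rewrite !exprS; ring.
rewrite (le_trans (ler_normD _ _))// -natr1 [leRHS]mulrDl mul1r lerD// normrM.
  by rewrite -[leRHS]mul1r ler_pM.
by rewrite ler_piMr// norm_expr_le1.
Qed.

Lemma subrX_taylor a q m : `|a| <= 1 -> `|q| <= 1 ->
  `|a ^+ m - q ^+ m - m%:R * q ^+ m.-1 * (a - q)| <= m%:R ^+ 2 * (a - q) ^+ 2.
Proof.
move=> a1 q1; elim: m => [|m IH].
  by rewrite !expr0 subrr !mul0r subr0 normr0 expr0n mul0r.
have -> : a ^+ m.+1 - q ^+ m.+1 - m.+1%:R * q ^+ m * (a - q) =
    a * (a ^+ m - q ^+ m - m%:R * q ^+ m.-1 * (a - q)) +
    m%:R * q ^+ m.-1 * (a - q) ^+ 2.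
  case: m {IH} => [|m]; first by rewrite !expr0 expr1; ring.
  by rewrite -[m.+2%:R]natr1 /= !exprS; ring.
rewrite (le_trans (ler_normD _ _))//.
rewrite (@le_trans _ _ (m%:R ^+ 2 * (a - q) ^+ 2 + m%:R * (a - q) ^+ 2))//.
  rewrite lerD//; first by rewrite normrM -[leRHS]mul1r ler_pM.
  rewrite normrM (ger0_norm (sqr_ge0 _)) ler_wpM2r ?sqr_ge0//.
  by rewrite normrM ger0_norm// ler_piMr// norm_expr_le1.
rewrite -mulrDl ler_wpM2r ?sqr_ge0// -natr1.
have : 0 <= m%:R :> R by []. nra.
Qed.

End PowerBounds.

Lemma sum_setU1 {V : nmodType} (T : finType) (j : T) (Q : pred {set T})
    (F : {set T} -> V) :
  \sum_(B : {set T} | (j \in B) && Q (B :\ j)%SET) F B =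
  \sum_(A : {set T} | (j \notin A) && Q A) F (j |: A)%SET.
Proof.
rewrite (reindex_onto (fun A => j |: A)%SET (fun B => B :\ j)%SET) /=; last first.
  by move=> B /andP[jB _]; exact: finset.setD1K.
apply: eq_bigl => A; rewrite setU11/=.
have [jA|jA] := boolP (j \in A); last by rewrite finset.setU1K// eqxx andbT.
apply/negbTE/negP => /andP[_ /eqP/setP/(_ j)].
by rewrite !inE jA eqxx.
Qed.

Section ElementarySymmetric.
Context {R : realType} (N : nat) (i : 'I_N) (x : 'I_N -> R).
Hypothesis x2 : forall j, x j * x j = 1.

(* The elementary symmetric polynomial of degree [m] in the [x j], [j != i]. *)
Definition elemsym m : R :=
  \sum_(A : {set 'I_N} | (i \notin A) && (#|A| == m)) \prod_(j in A) x j.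

Let S1 := \sum_(j | j != i) x j.

Let normx j : `|x j| = 1.
Proof.
by apply/eqP; rewrite -(@pexpr_eq1 _ _ 2)// -normrX expr2 x2 normr1.
Qed.

Let normprod (A : {set 'I_N}) : `|\prod_(j in A) x j| = 1.
Proof. by rewrite normr_prod big1// => j _; rewrite normx. Qed.

Lemma normr_elemsym m : `|elemsym m| <= 'C(N, m)%:R.
Proof.
rewrite (le_trans (ler_norm_sum _ _ _))//.
under eq_bigr do rewrite normprod.
rewrite sumr_const ler_nat -[X in 'C(X, _)](card_ord N) -card_draws.
apply: subset_leq_card; apply/fintype.subsetP => A.
by rewrite !inE unfold_in => /andP[].
Qed.

(** Multiplying [elemsym m] by the sum of the variables produces each set of size [m.+1] once for
    each of its elements. The error consists of the terms whose index already lies in the set, at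
    most [m] for each set. *)
Lemma elemsymS m : `|m.+1%:R * elemsym m.+1 - S1 * elemsym m| <= m%:R * 'C(N, m)%:R.
Proof.
have sumS : S1 * elemsym m = \sum_(j | j != i)
    (\sum_(A : {set 'I_N} | (j \notin A) && ((i \notin A) && (#|A| == m))) \prod_(k in (j |: A)%SET) x k
    + \sum_(A : {set 'I_N} | (j \in A) && ((i \notin A) && (#|A| == m))) x j * \prod_(k in A) x k).
  rewrite /S1 mulr_suml; apply: eq_bigr => j ji.
  rewrite /elemsym mulr_sumr (bigID (fun A : {set 'I_N} => j \notin A))/=.
  congr (_ + _); apply: eq_big => A.
  - by rewrite andbC.
  - by move=> /andP[_ jA]; rewrite big_setU1.
  - by rewrite negbK andbC.
  - by [].
have first_part : \sum_(j | j != i) \sum_(A : {set 'I_N} | (j \notin A) && ((i \notin A) && (#|A| == m)))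
    \prod_(k in (j |: A)%SET) x k = m.+1%:R * elemsym m.+1.
  under eq_bigr => j ji do rewrite -(sum_setU1 j (fun A => (i \notin A) && (#|A| == m)) (fun B => \prod_(k in B) x k)).
  rewrite /elemsym mulr_sumr.
  rewrite (exchange_big_dep (fun B : {set 'I_N} => (i \notin B) && (#|B| == m.+1)))/=; last first.
    move=> j B ji /andP[jB]; rewrite !inE negb_and negbK [i == j]eq_sym (negbTE ji)/=.
    by move=> /andP[-> /eqP mB]; rewrite (cardsD1 j B) jB mB add1n eqxx.
  apply: eq_bigr => B /andP[iB /eqP cB].
  rewrite (eq_bigl (mem B)); first by rewrite sumr_const cB mulr_natl.
  move=> j /=; rewrite !inE.
  have [jB|//] := boolP (j \in B); last by rewrite andbF.
  have ji : j != i by apply: contraNneq iB => <-.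
  rewrite ji/= negb_and negbK iB orbT/=.
  by move: cB; rewrite (cardsD1 j B) jB add1n => -[->]; rewrite eqxx.
rewrite sumS big_split/= first_part opprD addrA subrr add0r normrN.
rewrite (exchange_big_dep (fun A : {set 'I_N} => (i \notin A) && (#|A| == m)))/=; last first.
  by move=> j A ji /andP[].
rewrite (le_trans (ler_norm_sum _ _ _))//.
apply: (@le_trans _ _ (\sum_(A : {set 'I_N} | (i \notin A) && (#|A| == m)) m%:R)).
  apply: ler_sum => A /andP[iA /eqP cA].
  rewrite (le_trans (ler_norm_sum _ _ _))//.
  rewrite (eq_bigr (fun=> 1)); last by move=> j _; rewrite normrM normx normprod mul1r.
  rewrite sumr_const ler_nat -cA; apply: subset_leq_card.
  by apply/fintype.subsetP => j; rewrite unfold_in => /andP[_ /andP[]].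
rewrite sumr_const -[leLHS]mulr_natr ler_wpM2l// ler_nat.
rewrite -[X in 'C(X, _)](card_ord N) -card_draws.
apply: subset_leq_card; apply/fintype.subsetP => A.
by rewrite !inE unfold_in => /andP[].
Qed.

Lemma fact_bin_le_expn m : (m`! * 'C(N, m) <= N ^ m)%N.
Proof.
rewrite mulnC bin_ffact; elim: m => [//|m IH].
by rewrite ffactnSr expnSr leq_mul// leq_subr.
Qed.

Lemma fact_elemsym_le m : `|m`!%:R * elemsym m| <= N%:R ^+ m.
Proof.
rewrite normrM ger0_norm// (le_trans (ler_wpM2l _ (normr_elemsym m)))//.
by rewrite -natrM -natrX ler_nat fact_bin_le_expn.
Qed.

(** Ordered products without repetition are compared with all ordered products; repetitions are a
    fraction [O(1/N)] of them. Each step of the recursion adds [m] to the constant [m ^+ 2], which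
    stays below the square of [m.+1]. *)
Lemma elemsym_power m :
  `|m`!%:R * elemsym m - S1 ^+ m| <= m%:R ^+ 2 * N%:R ^+ m.-1.
Proof.
have S1N : `|S1| <= N%:R.
  rewrite (le_trans (ler_norm_sum _ _ _))//.
  under eq_bigr do rewrite normx.
  rewrite sumr_const ler_nat -[X in (_ <= X)%N](card_ord N); exact: max_card.
elim: m => [|m IH].
  rewrite expr0 fact0 mul1r expr0n mul0r /elemsym (big_pred1 finset.set0).
    by rewrite big_set0 subrr normr0.
  by move=> A /=; rewrite cards_eq0 /= andb_idl// => /eqP->; rewrite inE.
have -> : (m.+1)`!%:R * elemsym m.+1 - S1 ^+ m.+1 =
   m`!%:R * (m.+1%:R * elemsym m.+1 - S1 * elemsym m) + S1 * (m`!%:R * elemsym m - S1 ^+ m).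
  by rewrite factS natrM exprS; ring.
rewrite (le_trans (ler_normD _ _))// /=.
apply: (@le_trans _ _ (m%:R * N%:R ^+ m + m%:R ^+ 2 * N%:R ^+ m)).
  rewrite lerD//.
    rewrite normrM ger0_norm// (le_trans (ler_wpM2l _ (elemsymS m)))//.
    by rewrite mulrCA ler_wpM2l// -natrM -natrX ler_nat fact_bin_le_expn.
  rewrite normrM (le_trans (ler_pM _ _ S1N IH))//.
  by case: (m) => [|k]; [rewrite expr0n !mul0r mulr0|rewrite mulrCA -exprS].
rewrite -mulrDl ler_wpM2r ?exprn_ge0// -natr1.
have : 0 <= m%:R :> R by []. nra.
Qed.

End ElementarySymmetric.

Section Sites.
Context {R : realType} (N p : nat).

Definition site_set (t : psites N p) : {set 'I_N} := [set j in val t]%SET.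

Lemma psites_uniq (t : psites N p) : uniq (val (val t)).
Proof.
apply: (@map_uniq _ _ val); apply: (sorted_uniq ltn_trans ltnn); exact: (valP t).
Qed.

Lemma site_set_inj : injective site_set.
Proof.
move=> t t' tt'; apply/val_inj/val_inj/(inj_map val_inj).
apply: (irr_sorted_eq ltn_trans ltnn); [exact: (valP t)|exact: (valP t')|].
move=> j; apply/mapP/mapP => -[k kt ->]; exists k => //.
  by have /setP/(_ k) := tt'; rewrite !inE kt => <-.
by have /setP/(_ k) := tt'; rewrite !inE kt => ->.
Qed.

Lemma card_site_set t : #|site_set t| = p.
Proof.
by rewrite /site_set cardsE (card_uniqP (psites_uniq t)) size_tuple.
Qed.

(** Passing to sets is injective and both sides number ['C(N, p)], so surjectivity follows without
    sorting a set back into a tuple. *)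
Lemma sum_psites (F : {set 'I_N} -> R) :
  \sum_(t : psites N p) F (site_set t) = \sum_(A : {set 'I_N} | #|A| == p) F A.
Proof.
have setE : [set site_set t | t in [set: psites N p]]%SET =
    [set A : {set 'I_N} | #|A| == p]%SET.
  apply/eqP; rewrite eqEcard; apply/andP; split.
    by apply/fintype.subsetP => _ /imsetP[t _ ->]; rewrite inE card_site_set.
  rewrite card_imset; last exact: site_set_inj.
  by rewrite card_draws card_ord cardsT card_sig -card_ltn_sorted_tuples cardsE.
transitivity (\sum_(A in [set site_set t | t in [set: psites N p]]%SET) F A).
  rewrite big_imset/=; last by move=> t t' _ _; exact: site_set_inj.
  by apply: eq_bigl => t; rewrite inE.
by rewrite setE; apply: eq_bigl => A; rewrite inE.
Qed.

(** Removing [i] from the tuples through it leaves exactly the sets of [p.-1] other sites. This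
    yields the covariance of the part of the Hamiltonian that contains the spin at [i]. *)
Lemma sum_psites_mem (i : 'I_N) (x : 'I_N -> R) : (0 < p)%N ->
  \sum_(t : psites N p) (if i \in val t then \prod_(j <- val t) x j else 0) =
  x i * elemsym i x p.-1.
Proof.
move=> p0.
transitivity (\sum_(t : psites N p)
    (fun A : {set 'I_N} => if i \in A then \prod_(j in A) x j else 0) (site_set t)).
  apply: eq_bigr => t _; rewrite /site_set inE; case: ifP => // _.
  rewrite big_uniq ?psites_uniq//; apply: eq_bigl => j; by rewrite inE.
rewrite (sum_psites (fun A : {set 'I_N} => if i \in A then \prod_(j in A) x j else 0)).
rewrite -big_mkcondr/=.
transitivity (\sum_(B : {set 'I_N} | (i \in B) && (#|(B :\ i)%SET| == p.-1))
   \prod_(j in B) x j).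
  apply: eq_bigl => B; rewrite andbC; case: (boolP (i \in B)) => //= iB.
  by rewrite [in LHS](cardsD1 i B) iB add1n -[in LHS](prednK p0) eqSS.
rewrite (sum_setU1 i (fun A => #|A| == p.-1)) /elemsym mulr_sumr.
by apply: eq_bigr => A /andP[iA _]; rewrite big_setU1.
Qed.

End Sites.

Section Covariance.
Context {R : realType} (N p : nat) (i : 'I_N) (x : 'I_N -> R).
Hypothesis p_ge2 : (2 <= p)%N.
Hypothesis x2 : forall j, x j * x j = 1.

Let N_gt0 : 0 < N%:R :> R.
Proof. by rewrite ltr0n (leq_ltn_trans _ (ltn_ord i)). Qed.

Let u2 : R := @u_N R N p ^+ 2.

Let u2E : u2 = p%:R / 2 * ((p.-1)`!%:R / N%:R ^+ p.-1).
Proof.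
rewrite /u2 /u_N sqr_sqrtr; last by rewrite divr_ge0// mulr_ge0// exprn_ge0// ltW.
rewrite -[in p`!](prednK (ltnW p_ge2)) factS natrM prednK ?(ltnW p_ge2)//.
have : N%:R ^+ p.-1 != 0 :> R by rewrite gt_eqF// exprn_gt0.
by move=> ?; field.
Qed.

Lemma cavity_variance_le : `|u2 * elemsym i x p.-1| <= p%:R / 2.
Proof.
have a0 : 0 <= p%:R / 2 :> R by rewrite divr_ge0.
rewrite u2E -(mulrA (p%:R / 2)) normrM (ger0_norm a0) ler_piMr//.
rewrite mulrAC normrM normfV [X in _ / X]ger0_norm ?exprn_ge0 ?(ltW N_gt0)//.
by rewrite ler_pdivrMr ?exprn_gt0// mul1r fact_elemsym_le.
Qed.

(** [u_N ^+ 2] is [p / 2] times [(p-1)! / N^(p-1)], exactly the factor that turns [elemsym] into a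
    power of the overlap up to repeated indices. *)
Lemma cavity_variance_power :
  `|u2 * elemsym i x p.-1 - p%:R / 2 * (N%:R^-1 * \sum_(j | j != i) x j) ^+ p.-1|
    <= p%:R ^+ 3 / N%:R.
Proof.
have Np : 0 < N%:R ^+ p.-1 :> R by rewrite exprn_gt0.
have a0 : 0 <= p%:R / 2 :> R by rewrite divr_ge0.
rewrite u2E -(mulrA (p%:R / 2)) -(mulrBr (p%:R / 2)) exprMn exprVn.
rewrite [_^-1 * _]mulrC [_ / _ * _]mulrAC -mulrBl normrM (ger0_norm a0).
rewrite normrM normfV (ger0_norm (ltW Np)).
have H := elemsym_power i x2 p.-1.
have NE : N%:R ^+ p.-1 = N%:R * N%:R ^+ p.-2 :> R.
  by rewrite -exprS; case: (p) p_ge2 => [//|[]].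
rewrite (le_trans (ler_wpM2l _ (ler_wpM2r _ H)))// ?divr_ge0 ?invr_ge0 ?(ltW Np)//.
have N2 : 0 < N%:R ^+ p.-2 :> R by rewrite exprn_gt0.
rewrite NE.
have -> : p%:R / 2 * (p.-1%:R ^+ 2 * N%:R ^+ p.-2 / (N%:R * N%:R ^+ p.-2)) =
    p%:R / 2 * p.-1%:R ^+ 2 / N%:R :> R.
  by field; rewrite !gt_eqF.
by rewrite ler_wpM2r ?invr_ge0 ?(ltW N_gt0)// half_pred_sqr_le.
Qed.

End Covariance.

(** * Separating one spin from the others *)

Section OneSite.
Context {R : realType} {N : nat} (i : 'I_N).
Implicit Types (s t : config N).

Definition offsite (psi : (nat -> config N) -> R) :=
  forall sg sg' : nat -> config N,
    (forall l j, j != i -> sg l j = sg' l j) -> psi sg = psi sg'.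

(** Average the sum with its image under the flip of the spin at [i], which leaves [psi]
    unchanged. *)
Lemma sum_flip (phi : bool -> R) (psi : config N -> R) :
  (forall s t, (forall j, j != i -> s j = t j) -> psi s = psi t) ->
  \sum_(s : config N) phi (s i) * psi s = (phi true + phi false) / 2 * \sum_s psi s.
Proof.
move=> psiE.
pose flip s : config N := [ffun j => if j == i then ~~ s j else s j].
have flipK : involutive flip.
  move=> s; apply/ffunP => j; rewrite !ffunE; case: eqP => // _; exact: negbK.
have E : \sum_(s : config N) phi (s i) * psi s =
    \sum_(s : config N) phi (~~ s i) * psi s.
  rewrite (reindex_inj (inv_inj flipK)); apply: eq_bigr => s _.
  rewrite ffunE eqxx; congr (_ * _); apply: psiE => j ji.
  by rewrite ffunE (negbTE ji).
have D : \sum_(s : config N) phi (s i) * psi s +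
    \sum_(s : config N) phi (~~ s i) * psi s =
    (phi true + phi false) * \sum_s psi s.
  rewrite -big_split mulr_sumr/=; apply: eq_bigr => s _.
  by rewrite -mulrDl; case: (s i); rewrite //= addrC.
by rewrite mulrAC -D -E -mulr2n -[_ *+ 2]mulr_natr mulfK.
Qed.

(** [rho] is a weight on full configurations, uniform in the spin at [i]; the [2] compensates for
    summing it over both values of that spin. *)
Lemma avg_factor s0 (G rho : config N -> R) (alpha : bool -> R) n
    (phi : (nat -> bool) -> R) psi :
  (forall s, G s = 2 * alpha (s i) * rho s) ->
  (forall s t, (forall j, j != i -> s j = t j) -> rho s = rho t) ->
  offsite psi ->
  avg s0 G n (fun sg => phi (fun l => sg l i) * psi sg) =
  avg (s0 i) alpha n phi * avg s0 rho n psi.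
Proof.
move=> GE rhoE; elim: n phi psi => [//|n IH] phi psi psiE /=.
pose A c := avg (s0 i) alpha n (fun b => phi (scons c b)).
pose B s := avg s0 rho n (fun sg => psi (scons s sg)).
transitivity (\sum_(s : config N) (2 * alpha (s i) * A (s i)) * (rho s * B s)).
  apply: eq_bigr => s _; rewrite GE.
  rewrite (_ : avg _ _ _ _ = A (s i) * B s); first by ring.
  rewrite -IH; last first.
    move=> sg sg' e; apply: psiE => -[//|l] j ji /=; exact: e.
  congr avg; apply/funext => sg; congr (phi _ * _).
  by apply/funext => -[].
rewrite (sum_flip (fun c => 2 * alpha c * A c)); last first.
  move=> s t st; rewrite (rhoE s t st); congr (_ * avg _ _ _ _).
  apply/funext => sg; apply: psiE => -[|l] j ji //=; exact: st.
congr (_ * _); rewrite big_bool/=.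
by rewrite /A; field.
Qed.

End OneSite.

Lemma sqr_spin {R : realType} N (s : config N) j : spin s j * spin s j = 1 :> R.
Proof. by rewrite /spin -expr2 sqrr_sign. Qed.

Lemma norm_spin {R : realType} N (s : config N) j : `|spin s j : R| = 1.
Proof. by rewrite /spin normr_sign. Qed.

Section Gibbs2.
Context {R : realType} {N p : nat} (beta h : R).

Definition config0 : config N := [ffun=> false].

Definition spin_gibbs (x : psites N p -> R) :=
  gibbs (fun s => - hamiltonian beta h x s).

Lemma gibbs_average2 (x : psites N p -> R) (F : config N -> config N -> R) :
  gibbs_average beta h x (fun s : 2.-tuple (config N) => F (tnth s ord0) (tnth s ord_max))
  = avg config0 (spin_gibbs x) 2 (fun sg => F (sg 0%N) (sg 1%N)).
Proof.
pose H := hamiltonian beta h x.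
rewrite /gibbs_average.
rewrite (reindex (fun z : config N * config N => [tuple z.1; z.2])) /=; last first.
  exists (fun s : 2.-tuple (config N) => (tnth s ord0, tnth s ord_max)).
    by move=> [a b] _; congr pair.
  move=> [[|a [|b []]] //= sz] _; apply: val_inj => /=.
  by rewrite !(tnth_nth config0).
rewrite (eq_bigr (fun z : config N * config N =>
  F z.1 z.2 * (expR (- H z.1) * expR (- H z.2)))); last first.
  move=> [a b] _ /=; rewrite -expRD; congr (F _ _ * expR _).
  by rewrite !big_ord_recl big_ord0 addr0 opprD.
rewrite -(pair_big predT predT (fun a b => F a b * (expR (- H a) * expR (- H b))))/=.
rewrite mulr_sumr; apply: eq_bigr => a _.
rewrite !mulr_sumr; apply: eq_bigr => b _.
rewrite /spin_gibbs /gibbs /partition_function -/H expr2 invfM.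
by set Z := (_ ^-1); ring.
Qed.

End Gibbs2.

Definition normal_id {R : realType} (y : measurableTypeR R) : R := y.

Lemma measurable_normal_id {R : realType} :
  measurable_fun setT (@normal_id R : measurableTypeR R -> R).
Proof. by move=> _ B mB; rewrite setTI; exact: mB. Qed.

HB.instance Definition _ {R : realType} :=
  isMeasurableFun.Build _ _ (measurableTypeR R) R normal_id measurable_normal_id.

Definition normal_RV {R : realType} : {RV (@normal_prob R 0 1) >-> R} := normal_id.

Lemma standard_gaussian_normal_RV {R : realType} : standard_gaussian (@normal_RV R).
Proof. by move=> B mB. Qed.

(** * The cavity fields and the two ends of the path *)

Section Cavity.
Context {R : realType} {N p : nat} (beta h q : R) (i : 'I_N).
Hypothesis p_ge2 : (2 <= p)%N.
Hypothesis q01 : 0 <= q <= 1.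
Implicit Types (s t : config N).
Local Notation u_N := (@u_N R N p).

Definition site_prod s t j : R := spin s j * spin t j.

Lemma site_prod_sqr s t j : site_prod s t j * site_prod s t j = 1.
Proof. by rewrite /site_prod mulrACA !sqr_spin mulr1. Qed.

Lemma norm_site_prod s t j : `|site_prod s t j| = 1.
Proof. by rewrite /site_prod normrM !norm_spin mulr1. Qed.

Definition monomial (t : psites N p) s : R := beta * u_N * \prod_(j <- val t) spin s j.

(* [Some t] indexes the disorder variable of [t], and [None] the independent
   Gaussian variable that drives the field at the site [i]. *)
Definition cavity_field (o : option (psites N p)) s : R :=
  if o is Some t then (if i \in val t then monomial t s else 0) else 0.

Definition cavity_rest (o : option (psites N p)) s : R :=
  if o is Some t then (if i \in val t then 0 else monomial t s) else 0.

(** Kept in the form of the coefficient of [y] in [overlap_equation], which then applies as it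
    stands at the start of the path. *)
Definition cavity_scale : R := beta * Num.sqrt (p%:R / 2) * q `^ ((p%:R - 1) / 2).

Definition cavity_independent (o : option (psites N p)) s : R :=
  if o is None then cavity_scale * spin s i else 0.

Definition external_field s : R := h * \sum_(j < N) spin s j.

(* The difference of the covariances of the two fields, divided by the product
   of the spins at [i]. *)
Definition cov_gap s t : R :=
  beta ^+ 2 * (u_N ^+ 2 * elemsym i (site_prod s t) p.-1 - p%:R / 2 * q ^+ p.-1).

Lemma cavity_scale_sqr : cavity_scale ^+ 2 = beta ^+ 2 * (p%:R / 2 * q ^+ p.-1).
Proof.
have /andP[q0 _] := q01.
rewrite /cavity_scale !exprMn sqr_sqrtr ?divr_ge0// -mulrA; congr (_ * (_ * _)).
rewrite -(powR_mulrn 2 (powR_ge0 _ _)) -powRrM -(powR_mulrn p.-1 q0); congr (_ `^ _).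
by rewrite divfK// -[p in LHS]prednK ?(ltnW p_ge2)// -natr1 addrK.
Qed.

(** Both fields are the spin at [i] times something that does not depend on it, so [site_prod s t i]
    factors out of both covariances. *)
Lemma path_cov_cavity s t :
  path_cov cavity_field cavity_independent s t = site_prod s t i * cov_gap s t.
Proof.
rewrite /path_cov sum_option/= mul0r sub0r.
under eq_bigr do rewrite subr0.
rewrite (eq_bigr (fun k : psites N p => beta ^+ 2 * u_N ^+ 2 *
    (if i \in val k then \prod_(j <- val k) site_prod s t j else 0))); last first.
  move=> k _; case: ifP => _; last by rewrite !mulr0.
  by rewrite /monomial big_split/=; ring.
rewrite -mulr_sumr sum_psites_mem ?(ltnW p_ge2)// mulrACA -expr2 cavity_scale_sqr.
by rewrite /cov_gap /site_prod; ring.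
Qed.

(** Between a replica and itself all site products are [1]; this is the constant diagonal that lets
    coinciding replicas cancel. *)
Lemma cov_gap_diag s : cov_gap s s = cov_gap config0 config0.
Proof.
rewrite /cov_gap; congr (_ * (_ * elemsym i _ _ - _)); apply/funext => j.
by rewrite /site_prod !sqr_spin.
Qed.

Lemma norm_cov_gap s t : `|cov_gap s t| <= beta ^+ 2 * p%:R.
Proof.
have /andP[q0 q1] := q01.
rewrite /cov_gap normrM ger0_norm ?sqr_ge0// ler_wpM2l ?sqr_ge0//.
rewrite (le_trans (ler_normB _ _))//.
have := cavity_variance_le i p_ge2 (site_prod_sqr s t).
have q1' : `|q ^+ p.-1| <= 1 by apply: norm_expr_le1; rewrite ger0_norm.
have a0 : 0 <= p%:R / 2 :> R by rewrite divr_ge0.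
have : `|p%:R / 2 * q ^+ p.-1| <= p%:R / 2 by rewrite normrM (ger0_norm a0) ler_piMr.
lra.
Qed.

Definition cavity_gap s t : R := N%:R^-1 * (\sum_(j | j != i) site_prod s t j) - q.

Let N_gt0 : 0 < N%:R :> R.
Proof. by rewrite ltr0n (leq_ltn_trans _ (ltn_ord i)). Qed.

Lemma norm_cavity_overlap s t : `|N%:R^-1 * (\sum_(j | j != i) site_prod s t j)| <= 1.
Proof.
rewrite normrM normfV (ger0_norm (ltW N_gt0)) mulrC ler_pdivrMr// mul1r.
rewrite (le_trans (ler_norm_sum _ _ _))//.
under eq_bigr do rewrite norm_site_prod.
rewrite sumr_const ler_nat -[X in (_ <= X)%N](card_ord N); exact: max_card.
Qed.

Let norm_q : `|q| <= 1. Proof. by have /andP[q0 q1] := q01; rewrite ger0_norm. Qed.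

Lemma norm_cavity_gap s t : `|cavity_gap s t| <= 2.
Proof.
rewrite (le_trans (ler_normB _ _))//; have := norm_cavity_overlap s t.
by have := norm_q; lra.
Qed.

Lemma cov_gap_linear s t :
  `|cov_gap s t| <= beta ^+ 2 * (p%:R / 2 * p.-1%:R * `|cavity_gap s t| + p%:R ^+ 3 / N%:R).
Proof.
rewrite /cov_gap normrM ger0_norm ?sqr_ge0// ler_wpM2l ?sqr_ge0//.
have := cavity_variance_power i p_ge2 (site_prod_sqr s t).
have a0 : 0 <= p%:R / 2 :> R by rewrite divr_ge0.
have := ler_wpM2l a0 (subrX_bound p.-1 (norm_cavity_overlap s t) norm_q).
rewrite -/(cavity_gap s t) -[X in X <= _](ger0_norm (mulr_ge0 a0 (normr_ge0 _))).
rewrite normrM normr_id -normrM mulrA.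
set e := _ * elemsym _ _ _; set r := N%:R^-1 * _.
move=> h1 h2; rewrite (_ : _ - _ = p%:R / 2 * (r ^+ p.-1 - q ^+ p.-1) + (e - p%:R / 2 * r ^+ p.-1)).
  by rewrite (le_trans (ler_normD _ _))// lerD.
by ring.
Qed.

(** For the first moment the linear term must keep its sign: its mean is to be controlled, and not
    the mean of its absolute value. *)
Lemma cov_gap_taylor s t :
  `|cov_gap s t - beta ^+ 2 * (p%:R / 2 * p.-1%:R * q ^+ p.-2) * cavity_gap s t| <=
  beta ^+ 2 * (p%:R ^+ 3 * cavity_gap s t ^+ 2 + p%:R ^+ 3 / N%:R).
Proof.
rewrite /cov_gap -(mulrA (beta ^+ 2)) -(mulrBr (beta ^+ 2)) normrM ger0_norm ?sqr_ge0// ler_wpM2l ?sqr_ge0//.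
have h1 := cavity_variance_power i p_ge2 (site_prod_sqr s t).
have a0 : 0 <= p%:R / 2 :> R by rewrite divr_ge0.
have h2 := subrX_taylor p.-1 (norm_cavity_overlap s t) norm_q.
rewrite -/(cavity_gap s t) in h2.
move: h1 h2; set e := _ * elemsym _ _ _; set r := N%:R^-1 * _; set D := cavity_gap s t.
move=> h1 h2.
rewrite (_ : _ - _ = p%:R / 2 * (r ^+ p.-1 - q ^+ p.-1 - p.-1%:R * q ^+ p.-2 * D)
   + (e - p%:R / 2 * r ^+ p.-1)); last by ring.
rewrite (le_trans (ler_normD _ _))// lerD// normrM (ger0_norm a0).
by rewrite (le_trans (ler_wpM2l a0 h2))// mulrA ler_wpM2r ?sqr_ge0// half_pred_sqr_le.
Qed.

End Cavity.

Section OneBit.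
Context {R : realType}.

Definition bit_gibbs (a : R) : bool -> R := gibbs (fun c : bool => a * (-1) ^+ c).

Lemma bit_gibbs_mean a : \sum_c bit_gibbs a c * (-1) ^+ c = tanh a.
Proof.
rewrite !big_bool/= /bit_gibbs /gibbs !big_bool/= expr1 expr0 !mulr1 mulrN1 mulrN1.
by rewrite /tanh [expR (- a) + _]addrC mulrBl addrC.
Qed.

Lemma avg_bit_gibbs2 c0 a q :
  avg c0 (bit_gibbs a) 2 (fun b => (-1) ^+ b 0%N * (-1) ^+ b 1%N - q) = tanh a ^+ 2 - q.
Proof.
rewrite avgB avg_cst//; last exact: (gibbs_sum1 c0).
congr (_ - _); rewrite -bit_gibbs_mean expr2 /= mulr_suml; apply: eq_bigr => c _.
rewrite -mulrA; congr (_ * _); rewrite mulr_sumr; apply: eq_bigr => c' _.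
by rewrite mulrCA.
Qed.

Lemma measurable_bit_avg c0 (a : measurableTypeR R -> R) n phi :
  measurable_fun setT a ->
  measurable_fun setT (fun y => avg c0 (bit_gibbs (a y)) n phi).
Proof.
move=> ma; apply: measurable_avg => c; apply: measurable_gibbs => // {}c.
exact: measurable_funM.
Qed.

End OneBit.

Section CavityMeasure.
Context {R : realType} {N p : nat} (beta h q : R).
Hypothesis p_ge2 : (2 <= p)%N.
Hypothesis q01 : 0 <= q <= 1.
Context d (T : measurableType d) (P : probability T R) (g : psites N p -> {RV P >-> R}).
Hypothesis g_gauss : forall t, standard_gaussian (g t).
Hypothesis g_indep : mutually_independent g.
Variable i : 'I_N.

Let gam : probability (measurableTypeR R) R := @normal_prob R 0 1.

Definition extended_disorder : option (psites N p) -> T * measurableTypeR R -> R :=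
  add_variable (fun t w => g t w) (@normal_RV R).

Lemma integrable_extended_disorder o :
  (P \x gam)%E.-integrable setT (EFin \o extended_disorder o).
Proof.
apply: integrable_add_variable => [t|].
- exact: integrable_standard_gaussian.
- exact: standard_gaussian_normal_RV.
Qed.

Lemma extended_disorder_ibp : gaussian_ibp (P \x gam)%E extended_disorder.
Proof.
apply: gaussian_ibp_add_variable => [t||].
- exact: integrable_standard_gaussian.
- exact: gaussian_ibp_indep_family.
- exact: standard_gaussian_normal_RV.
Qed.

Definition cavity_gibbs th w := path_gibbs extended_disorder
  (cavity_field beta i) (cavity_independent beta q i) (cavity_rest beta i)
  (external_field h) th w.

Definition cavity_nu th n (f : (nat -> config N) -> R) : R :=
  nu_path (P \x gam)%E config0 extended_disorder
    (cavity_field beta i) (cavity_independent beta q i) (cavity_rest beta i)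
    (external_field h) th n f.

Definition gibbs_nu n (f : (nat -> config N) -> R) : R :=
  \int[P]_w avg config0 (spin_gibbs beta h (g^~ w)) n f.

Lemma cavity_nu_fubini th n f : cavity_nu th n f =
  \int[P]_w \int[gam]_y avg config0 (cavity_gibbs th (w, y)) n f.
Proof.
rewrite /cavity_nu /nu_path Rfubini12//.
- apply: integrable_path_avg => o; exact: integrable_extended_disorder.
- move=> w; have [C CP] := avg_le1_bounded config0 n f.
  apply: (@integrable_bounded _ _ _ gam
    (fun y => avg config0 (cavity_gibbs th (w, y)) n f) C).
    apply: (measurableT_comp (f := fun z => avg config0 (cavity_gibbs th z) n f)).
      apply: (@measurable_path_avg _ _ _ (P \x gam)%E) => o.
      exact: integrable_extended_disorder.
    exact: measurable_pair1.
  move=> y; apply: CP; [exact: (gibbs_ge0 config0)|exact: (gibbs_sum1 config0)].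
Qed.

Lemma cavity_gibbs_end w y : cavity_gibbs (pi / 2) (w, y) = spin_gibbs beta h (g^~ w).
Proof.
rewrite /cavity_gibbs /path_gibbs /spin_gibbs; congr gibbs; apply/funext => s.
rewrite /field sum_option /path_coef sin_pihalf cos_pihalf /hamiltonian opprK.
rewrite /= mul0r mulr0 !addr0 mul0r add0r /external_field; congr (_ + _).
rewrite mulr_sumr; apply: eq_bigr => t _.
rewrite mul1r mulr0 addr0 /monomial.
by case: ifP => _; rewrite ?addr0 ?add0r; ring.
Qed.

Lemma cavity_nu_end n f : cavity_nu (pi / 2) n f = gibbs_nu n f.
Proof.
rewrite cavity_nu_fubini; apply: eq_Rintegral => w _.
under eq_Rintegral do rewrite cavity_gibbs_end.
by rewrite (Rintegral_cst gam measurableT) [X in fine X](probability_setT gam) mulr1.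
Qed.

Let scale := @cavity_scale R p beta q.

Let Hrest (w : T) (s : config N) : R :=
  \sum_(t : psites N p) cavity_rest beta i (Some t) s * g t w + h * \sum_(j | j != i) spin s j.

Let Hrest_offsite w (s t : config N) :
  (forall j, j != i -> s j = t j) -> Hrest w s = Hrest w t.
Proof.
move=> st; rewrite /Hrest; congr (_ + _ * _); last first.
  by apply: eq_bigr => j ji; rewrite /spin st.
apply: eq_bigr => k _; congr (_ * _); rewrite /cavity_rest; case: ifPn => // ik.
rewrite /monomial; congr (_ * _); apply: eq_big_seq => j jk.
by rewrite /spin st//; apply: contraNneq ik => <-.
Qed.

(** At [th = 0] only the field [scale * y + h] acts on the spin at [i], and [Hrest] does not see
    that spin. The [2] undoes the uniform weight that [gibbs (Hrest w)] gives to it. *)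
Lemma cavity_gibbs_start w y s : cavity_gibbs 0 (w, y) s =
  2 * bit_gibbs (scale * y + h) (s i) * gibbs (Hrest w) s.
Proof.
have HE (t : config N) : field (path_coef (cavity_field beta i) (cavity_independent beta q i)
    (cavity_rest beta i) 0) (external_field h) (extended_disorder^~ (w, y)) t =
    (scale * y + h) * (-1) ^+ t i + Hrest w t.
  rewrite /field sum_option /path_coef sin0 cos0 /Hrest /external_field.
  rewrite /= mulr0 add0r addr0 mul1r /normal_id.
  rewrite (bigD1 i)//= mulrDr -/(spin t i) mulrDl.
  rewrite (eq_bigr (fun k => cavity_rest beta i (Some k) t * g k w)); last first.
    by move=> k _ /=; rewrite mul0r mulr0 !add0r.
  by rewrite -/scale /spin; ring.
rewrite /cavity_gibbs /path_gibbs /gibbs.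
under eq_bigr do rewrite HE expRD.
rewrite (sum_flip (i := i) (fun c => expR ((scale * y + h) * (-1) ^+ c))
  (psi := fun s => expR (Hrest w s))); last by move=> ? ? e; rewrite (Hrest_offsite w e).
rewrite HE expRD /bit_gibbs /gibbs [in RHS]big_bool.
have A0 := expR_gt0 ((scale * y + h) * (-1) ^+ true).
have B0 := expR_gt0 ((scale * y + h) * (-1) ^+ false).
have Z0 := sum_expR_gt0 (@config0 N) (Hrest w).
set A := expR (_ * _ ^+ true) in A0 *; set B := expR (_ * _ ^+ false) in B0 *.
set Z := \sum_s _ in Z0 *.
have E (a c A' B' Z' : R) : 0 < A' -> 0 < B' -> 0 < Z' ->
    a * c / ((A' + B') / 2 * Z') = 2 * (a / (A' + B')) * (c / Z').
  by move=> *; field; rewrite !gt_eqF ?addr_gt0.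
exact: E.
Qed.

(** The default bit is that of the default configuration at [i], as in [avg_factor]. *)
Definition bit_nu n (phi : (nat -> bool) -> R) : R :=
  \int[gam]_y avg ((@config0 N) i) (bit_gibbs (scale * y + h)) n phi.

Let bit_integrable n phi : gam.-integrable setT
  (EFin \o (fun y : measurableTypeR R => avg ((@config0 N) i) (bit_gibbs (scale * y + h)) n phi)).
Proof.
have [C CP] := avg_le1_bounded ((@config0 N) i) n phi.
apply: (@integrable_bounded _ _ _ gam _ C); last first.
  by move=> y; apply: CP; [exact: (gibbs_ge0 true)|exact: (gibbs_sum1 true)].
by apply: measurable_bit_avg; apply: measurable_funD.
Qed.

Lemma cavity_nu_factor n phi psi : offsite i psi ->
  cavity_nu 0 n (fun sg => phi (fun l => sg l i) * psi sg) =
  bit_nu n phi * cavity_nu 0 n psi.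
Proof.
move=> psiE.
(* The weight of the spin at [i] depends on [y] alone and that of the other spins on [w] alone, so
   Fubini splits the integral. *)
have key phi' : cavity_nu 0 n (fun sg => phi' (fun l => sg l i) * psi sg) =
    bit_nu n phi' * \int[P]_w avg config0 (gibbs (Hrest w)) n psi.
  rewrite cavity_nu_fubini.
  have rE w (s t : config N) : (forall j, j != i -> s j = t j) ->
      gibbs (Hrest w) s = gibbs (Hrest w) t.
    by move=> st; rewrite /gibbs (Hrest_offsite w st).
  under eq_Rintegral => w _.
    under eq_Rintegral => y _ do
      rewrite (avg_factor config0 n phi' (fun s => cavity_gibbs_start w y s) (@rE w) psiE).
    rewrite RintegralZr//.
    over.
  rewrite RintegralZl//.
  have [C CP] := avg_le1_bounded config0 n psi.
  apply: (@integrable_bounded _ _ _ P _ C); last first.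
    by move=> w; apply: CP; [exact: (gibbs_ge0 config0)|exact: (gibbs_sum1 config0)].
  apply: measurable_avg => s; apply: measurable_gibbs => // {}s.
  apply: measurable_funD => //; apply: measurable_sum_fin => t.
  exact: measurable_funM.
rewrite (key phi); congr (_ * _).
(* The constant [1] for [phi'] identifies the factor of the other spins as [cavity_nu 0 n psi]. *)
have := key (fun=> 1); rewrite (_ : bit_nu n _ = 1) ?mul1r => [<-|].
  by congr cavity_nu; apply/funext => sg; rewrite mul1r.
rewrite /bit_nu; under eq_Rintegral do rewrite avg_cst ?(gibbs_sum1 true)//.
by rewrite (Rintegral_cst gam measurableT) [X in fine X](probability_setT gam) mulr1.
Qed.

Lemma bit_nu_bound n phi C : (forall b, `|phi b| <= C) -> `|bit_nu n phi| <= C.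
Proof.
move=> phiC; have C0 : 0 <= C := le_trans (normr_ge0 _) (phiC (fun=> true)).
rewrite (le_trans (le_normr_Rintegral _ _))//.
rewrite -[leRHS]mulr1 -[X in _ * X]/(fine 1%E) -(probability_setT gam).
rewrite -(Rintegral_cst gam measurableT); apply: le_Rintegral => //.
- exact: (integrable_abse (bit_integrable n phi)).
- exact: finite_measure_integrable_cst.
- move=> y _; apply: avg_bound => //; [exact: (gibbs_ge0 true)|exact: (gibbs_sum1 true)].
Qed.

(** Given the field, the two replicas of a single spin are independent, each with mean the [tanh] of
    the field. *)
Lemma bit_nu_overlap : overlap_equation p beta h q ->
  bit_nu 2 (fun b => (-1) ^+ b 0%N * (-1) ^+ b 1%N - q) = 0.
Proof.
rewrite /overlap_equation unlock => hq.
rewrite /bit_nu; under eq_Rintegral do rewrite avg_bit_gibbs2.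
have it : gam.-integrable setT
    (EFin \o (fun y : measurableTypeR R => tanh (scale * y + h) ^+ 2 - q)).
  rewrite (_ : (fun y => _) = (fun y : measurableTypeR R => avg ((@config0 N) i)
    (bit_gibbs (scale * y + h)) 2 (fun b => (-1) ^+ b 0%N * (-1) ^+ b 1%N - q)))//.
  by apply/funext => y; rewrite avg_bit_gibbs2.
have iq : gam.-integrable setT (EFin \o (cst q : measurableTypeR R -> R)).
  exact: finite_measure_integrable_cst.
have it2 : gam.-integrable setT (EFin \o (fun y : measurableTypeR R => tanh (scale * y + h) ^+ 2)).
  rewrite (_ : _ \o _ = (fun y => (tanh (scale * y + h) ^+ 2 - q)%:E + (cst q y)%:E)%E).
    by apply: integrableD.
  by apply/funext => y; rewrite -EFinD subrK.
rewrite RintegralB//.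
rewrite (Rintegral_cst gam measurableT) [X in fine X](probability_setT gam) mulr1.
by rewrite /Rintegral -hq subrr.
Qed.

End CavityMeasure.

Lemma ler_norm_dist {R : realDomainType} (a b c : R) : `|a - b| <= c -> `|b| <= `|a| + c.
Proof.
move=> abc; rewrite -{1}[b](subKr a) (le_trans (ler_normB _ _))//.
by rewrite lerD2l.
Qed.

(** * Estimates at one site *)

Section SiteEstimates.
Context {R : realType} {N p : nat} (beta h q : R).
Hypothesis p_ge2 : (2 <= p)%N.
Hypothesis q01 : 0 <= q <= 1.
Hypothesis hq : overlap_equation p beta h q.
Context d (T : measurableType d) (P : probability T R) (g : psites N p -> {RV P >-> R}).
Hypothesis g_gauss : forall t, standard_gaussian (g t).
Hypothesis g_indep : mutually_independent g.
Variable i : 'I_N.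

Local Notation x s t := (@site_prod R N s t i).
Local Notation D s t := (cavity_gap q i s t).
Local Notation B s t := (@cov_gap R N p beta q i s t).
Local Notation C := (cavity_nu beta h q g i).
Local Notation field_u := (@cavity_field R N p beta i).
Local Notation field_v := (@cavity_independent R N p beta q i).
Local Notation field_r := (@cavity_rest R N p beta i).

Let dC th n f := nu_path_deriv (P \x (@normal_prob R 0 1))%E config0 (extended_disorder g)
  field_u field_v field_r (external_field h) th n f.

Let ix := integrable_extended_disorder g_gauss.
Let ibp := extended_disorder_ibp g_gauss g_indep.

Let uv0 o (s t : config N) : field_u o s * field_v o t = 0.
Proof. by case: o => [k|] /=; rewrite ?mulr0 ?mul0r. Qed.

Let ur0 o (s t : config N) : field_u o s * field_r o t = 0.
Proof. by case: o => [k|] /=; [case: ifP|]; rewrite ?mulr0 ?mul0r. Qed.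

Let vr0 o (s t : config N) : field_v o s * field_r o t = 0.
Proof. by case: o => [k|] /=; rewrite ?mulr0 ?mul0r. Qed.

Let is_derive_C th n f : depends n f ->
  is_derive th (1:R) (fun y => C y n f) (sin th * cos th * dC th n f).
Proof. by move=> df; apply: is_derive_nu_path. Qed.

Let norm_C th n (f f' : (nat -> config N) -> R) : (forall sg, `|f sg| <= f' sg) ->
  `|C th n f| <= C th n f'.
Proof.
move=> ff'; apply: (le_trans (ler_norm_nu_path _ ix _ _ _ _ _ _ _)).
exact: ler_nu_path.
Qed.

Let path_covE s t : path_cov field_u field_v s t = x s t * B s t.
Proof. exact: path_cov_cavity. Qed.

Let norm_path_cov s t : `|path_cov field_u field_v s t| = `|B s t|.
Proof. by rewrite path_covE normrM norm_site_prod mul1r. Qed.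

Let dC_bound th n f b : 0 <= b ->
  (forall l m, (l < n.+1)%N -> (m < n.+2)%N -> l != m ->
    `|C th n.+2 (fun sg => f sg * path_cov field_u field_v (sg l) (sg m))| <= b) ->
  `|dC th n f| <= 4 * n%:R * n.+1%:R * b.
Proof.
move=> b0 fb.
have diag s : path_cov field_u field_v s s = path_cov field_u field_v (@config0 N) (@config0 N).
  by rewrite !path_covE cov_gap_diag /site_prod !sqr_spin.
by rewrite /dC; apply: nu_path_deriv_bound => //; exact: diag.
Qed.

Let depends01 (F : config N -> config N -> R) : depends 2 (fun sg => F (sg 0%N) (sg 1%N)).
Proof. by move=> sg sg' e; rewrite !e. Qed.

Let N_gt0 : 0 < N%:R :> R.
Proof. by rewrite ltr0n (leq_ltn_trans _ (ltn_ord i)). Qed.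

Let M th := C th 2 (fun sg => D (sg 0%N) (sg 1%N) ^+ 2).

Let M_ge0 th : 0 <= M th.
Proof. by apply: nu_path_ge0 => // sg; exact: sqr_ge0. Qed.

Let M_marg th n l m : (l < n)%N -> (m < n)%N -> l != m ->
  C th n (fun sg => D (sg l) (sg m) ^+ 2) = M th.
Proof. by move=> ln mn lm; exact: (nu_path_marg2 _ _ _ _ _ _ _ _ (fun s t => D s t ^+ 2)). Qed.

Let E0 := expR (12 * (beta ^+ 2 * p%:R)).

Let beta2p : 0 <= beta ^+ 2 * p%:R.
Proof. by rewrite mulr_ge0// sqr_ge0. Qed.

(** With two replicas the coefficients have total mass [4 * 2 * 3 = 24], and each covariance is at
    most [beta ^+ 2 * p%:R]. Gronwall halves this constant, hence the [12] in [E0]. *)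
Lemma second_moment_gronwall th : 0 <= th <= pi / 2 -> M th <= E0 * M (pi / 2).
Proof.
move=> th01.
have c0 : 0 <= 24 * (beta ^+ 2 * p%:R) by rewrite mulr_ge0.
rewrite /E0 (_ : 12 * _ = 24 * (beta ^+ 2 * p%:R) / 2); last by field.
apply: (sincos_gronwall (psi := fun th => dC th 2 (fun sg => D (sg 0%N) (sg 1%N) ^+ 2))) => //.
  by move=> y; apply: is_derive_C; exact: (depends01 (fun s t => D s t ^+ 2)).
move=> y _.
have := @dC_bound y 2 (fun sg => D (sg 0%N) (sg 1%N) ^+ 2) (beta ^+ 2 * p%:R * M y) _ _.
rewrite (_ : 4 * 2 * 3 * _ = 24 * (beta ^+ 2 * p%:R) * M y); last by ring.
apply; first by rewrite mulr_ge0.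
move=> l m _ _ _.
rewrite -(@M_marg y 4 0 1)// -nu_pathZ//; apply: norm_C => sg.
rewrite normrM norm_path_cov ger0_norm ?sqr_ge0// mulrC ler_wpM2r ?sqr_ge0//.
exact: norm_cov_gap.
Qed.

Let A0 := beta ^+ 2 * (p%:R / 2 * p.-1%:R).
Let Q := beta ^+ 2 * p%:R ^+ 3.

Let A0_ge0 : 0 <= A0. Proof. by rewrite /A0 mulr_ge0 ?sqr_ge0// mulr_ge0// divr_ge0. Qed.
Let Q_ge0 : 0 <= Q. Proof. by rewrite /Q mulr_ge0 ?sqr_ge0 ?exprn_ge0. Qed.

Let B_linear s t : `|B s t| <= A0 * `|D s t| + Q / N%:R.
Proof.
rewrite (le_trans (cov_gap_linear _ _ p_ge2 q01 _ _))//.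
by rewrite /A0 /Q mulrDr !mulrA.
Qed.

Let norm_D s t : `|D s t| <= 2. Proof. exact: norm_cavity_gap. Qed.

Let norm_xq s t : `|x s t - q| <= 2.
Proof.
have /andP[q0 q1] := q01.
by rewrite (le_trans (ler_normB _ _))// norm_site_prod ger0_norm//; lra.
Qed.

Let f2 (sg : nat -> config N) : R := (x (sg 0%N) (sg 1%N) - q) * D (sg 0%N) (sg 1%N).

Let D_offsite n m : offsite i (fun sg => D (sg n) (sg m)).
Proof.
move=> sg sg' e; rewrite /cavity_gap; congr (_ * _ - _).
by apply: eq_bigr => j ji; rewrite /site_prod /spin !e.
Qed.

Let B_offsite n m : offsite i (fun sg => B (sg n) (sg m)).
Proof.
move=> sg sg' e; rewrite /cov_gap; congr (_ * (_ * _ - _)).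
apply: eq_bigr => A /andP[iA _]; apply: eq_bigr => j jA.
have ji : j != i by apply: contraNneq iA => <-.
by rewrite /site_prod /spin !e.
Qed.

Let phi1 (b : nat -> bool) : R := (-1) ^+ b 0%N * (-1) ^+ b 1%N - q.

Let pih : 0 <= pi / 2 :> R. Proof. by rewrite divr_ge0// pi_ge0. Qed.

Lemma second_moment_site :
  `|gibbs_nu beta h g 2 f2| <=
  24 * A0 * E0 * gibbs_nu beta h g 2 (fun sg => D (sg 0%N) (sg 1%N) ^+ 2) + 48 * (Q / N%:R).
Proof.
rewrite -!(cavity_nu_end beta h q g_gauss i).
have f20 : C 0 2 f2 = 0.
  have := cavity_nu_factor beta h q g_gauss 2 phi1 (D_offsite 0 1).
  by rewrite bit_nu_overlap// mul0r.
rewrite -[X in `|X|]subr0 -f20.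
set Mp := C (pi / 2) 2 (fun sg => D (sg 0%N) (sg 1%N) ^+ 2).
rewrite (_ : 24 * A0 * E0 * Mp + _ = 24 * (2 * A0 * (E0 * Mp) + 4 * (Q / N%:R)) / 2);
  last by field; rewrite gt_eqF.
apply: (@sincos_derive_dist _ (fun th => C th 2 f2) (fun th => dC th 2 f2)) => //.
  move=> th; apply: is_derive_C; exact: (depends01 (fun s t => (x s t - q) * D s t)).
move=> th th01.
have := @dC_bound th 2 f2 (2 * A0 * (E0 * Mp) + 4 * (Q / N%:R)) _ _.
rewrite (_ : 4 * 2 * 3 * _ = 24 * (2 * A0 * (E0 * Mp) + 4 * (Q / N%:R))); last by ring.
apply.
  apply: addr_ge0; apply: mulr_ge0 => //; first exact: mulr_ge0.
    by apply: mulr_ge0; [exact: expR_ge0|exact: M_ge0].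
  exact: divr_ge0 (ltW N_gt0).
move=> l m l3 m4 lm.
(* From [|x - q| <= 2] and [2 * a * b <= a ^+ 2 + b ^+ 2] come two second moments, both equal to
   [M th] by exchangeability; [|D| <= 2] turns the remainder into [4 * (Q / N%:R)]. *)
apply: (@le_trans _ _ (C th 4 (fun sg => A0 * D (sg 0%N) (sg 1%N) ^+ 2 +
    (A0 * D (sg l) (sg m) ^+ 2 + 4 * (Q / N%:R))))).
  apply: norm_C => sg; rewrite /f2 !normrM norm_path_cov.
  have := B_linear (sg l) (sg m); have := norm_xq (sg 0%N) (sg 1%N).
  have := norm_D (sg 0%N) (sg 1%N).
  rewrite -[D (sg 0%N) (sg 1%N) ^+ 2]real_normK ?num_real//.
  rewrite -[D (sg l) (sg m) ^+ 2]real_normK ?num_real//.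
  have QN : 0 <= Q / N%:R by rewrite divr_ge0 ?(ltW N_gt0).
  move: QN (normr_ge0 (D (sg 0%N) (sg 1%N))) (normr_ge0 (D (sg l) (sg m)))
    (normr_ge0 (B (sg l) (sg m))) (normr_ge0 (x (sg 0%N) (sg 1%N) - q)).
  set QN := Q / _; set a := `|D _ _|; set b := `|D _ _|; set c := `|B _ _|; set e := `|_ - q|.
  move=> QN0 a0 b0 c0 e0 a2 e2 cb.
  apply: (@le_trans _ _ (2 * a * (A0 * b + QN))).
    by rewrite ler_pM ?mulr_ge0// ler_wpM2r.
  have := sqr_ge0 (a - b); move: A0_ge0; nra.
rewrite /cavity_nu nu_pathD// nu_pathD// nu_pathZ// nu_pathZ// nu_path_cst//.
rewrite -/(cavity_nu beta h q g i th 4 _) (@M_marg th 4 0 1)//.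
rewrite -/(cavity_nu beta h q g i th 4 _) (@M_marg th 4 l m)//; last exact: ltnW.
have HM : A0 * M th <= A0 * (E0 * Mp) := ler_wpM2l A0_ge0 (second_moment_gronwall th01).
by rewrite addrA lerD2r -mulrA mulr2n mulrDl !mul1r lerD.
Qed.

(** A bound, valid along the whole path, on the second moment of [cov_gap]: as [A0 <= Q], that gap
    is at most [Q * (|D| + 1/N)], and [(a + r) ^+ 2 <= 2 * (a ^+ 2 + r)] when [0 <= r <= 1]. *)
Let W := 2 * Q ^+ 2 * (E0 * M (pi / 2) + N%:R^-1).

Let W_ge0 : 0 <= W.
Proof.
rewrite /W; apply: mulr_ge0; first by rewrite mulr_ge0 ?sqr_ge0.
by rewrite addr_ge0 ?mulr_ge0 ?expR_ge0 ?M_ge0 ?invr_ge0 ?(ltW N_gt0).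
Qed.

Let A0_le_Q : A0 <= Q.
Proof.
rewrite /A0 /Q ler_wpM2l ?sqr_ge0// (le_trans _ (half_pred_sqr_le _ p))//.
rewrite ler_wpM2l ?divr_ge0// expr2 ler_peMl// ler1n.
by case: (p) p_ge2 => [|[]].
Qed.

Let B_second_moment th n l m : 0 <= th <= pi / 2 ->
  (l < n)%N -> (m < n)%N -> l != m -> C th n (fun sg => B (sg l) (sg m) ^+ 2) <= W.
Proof.
move=> th01 ln mn lm.
apply: (@le_trans _ _ (C th n (fun sg => 2 * Q ^+ 2 * (D (sg l) (sg m) ^+ 2 + N%:R^-1)))).
  apply: ler_nu_path => // sg.
  rewrite -[B _ _ ^+ 2]real_normK ?num_real// -[D _ _ ^+ 2]real_normK ?num_real//.
  have := B_linear (sg l) (sg m).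
  have N1 : 0 <= N%:R^-1 :> R by rewrite invr_ge0 (ltW N_gt0).
  have N2 : N%:R^-1 <= 1 :> R.
    by rewrite invf_le1// ler1n (leq_ltn_trans _ (ltn_ord i)).
  move: (normr_ge0 (D (sg l) (sg m))) (normr_ge0 (B (sg l) (sg m))) N1 N2.
  set a := `|D _ _|; set c := `|B _ _|; set r := N%:R^-1 => a0 c0 r0 r1 ca.
  have cQ : c <= Q * (a + r).
    rewrite mulrDr (le_trans ca)// lerD2r ler_wpM2r//.
  apply: (@le_trans _ _ ((Q * (a + r)) ^+ 2)).
    by rewrite lerXn2r ?nnegrE// mulr_ge0// addr_ge0.
  rewrite exprMn [2 * Q ^+ 2]mulrC -[leRHS]mulrA ler_wpM2l ?sqr_ge0//.
  have := sqr_ge0 (a - r); nra.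
rewrite /cavity_nu nu_pathZ// nu_pathD// nu_path_cst// -/(cavity_nu beta h q g i th n _) M_marg//.
apply: ler_wpM2l; first by rewrite mulr_ge0// sqr_ge0.
by apply: lerD => //; exact: second_moment_gronwall.
Qed.

Let f1 (sg : nat -> config N) : R := x (sg 0%N) (sg 1%N) - q.

(** The factorisation yields a mean of [B] at [th = 0], while the true Gibbs measure is at [pi / 2].
    The derivative is quadratic in [B], so moving between the two ends costs only a multiple of
    [W]. *)
Let cov_start : `|C 0 2 (fun sg => B (sg 0%N) (sg 1%N))| <=
  `|C (pi / 2) 2 (fun sg => B (sg 0%N) (sg 1%N))| + 12 * W.
Proof.
have H : `|C (pi / 2) 2 (fun sg => B (sg 0%N) (sg 1%N)) -
    C 0 2 (fun sg => B (sg 0%N) (sg 1%N))| <= 24 * W / 2.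
  apply: (@sincos_derive_dist _ (fun th => C th 2 (fun sg => B (sg 0%N) (sg 1%N)))
    (fun th => dC th 2 (fun sg => B (sg 0%N) (sg 1%N)))) => //.
    by move=> th; apply: is_derive_C; exact: (depends01 (fun s t => B s t)).
  move=> th th01.
  have := @dC_bound th 2 (fun sg => B (sg 0%N) (sg 1%N)) W _ _.
  rewrite (_ : 4 * 2 * 3 * _ = 24 * W); last by ring.
  apply=> // l m l3 m4 lm.
  apply: (@le_trans _ _ (C th 4 (fun sg =>
    2^-1 * (B (sg 0%N) (sg 1%N) ^+ 2 + B (sg l) (sg m) ^+ 2)))).
    apply: norm_C => sg; rewrite normrM norm_path_cov.
    rewrite -[B (sg 0%N) (sg 1%N) ^+ 2]real_normK ?num_real//.
    rewrite -[B (sg l) (sg m) ^+ 2]real_normK ?num_real//.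
    have := sqr_ge0 (`|B (sg 0%N) (sg 1%N)| - `|B (sg l) (sg m)|); nra.
  rewrite /cavity_nu nu_pathZ// nu_pathD//.
  have := @B_second_moment th 4 0 1 th01; have := @B_second_moment th 4 l m th01.
  rewrite /cavity_nu => /(_ (ltnW l3) m4 lm) h1 /(_ isT isT isT) h2; lra.
apply: le_trans (ler_norm_dist H) _; rewrite lerD2l; lra.
Qed.

Lemma first_moment_site :
  `|gibbs_nu beta h g 2 f1| <=
  24 * `|gibbs_nu beta h g 2 (fun sg => B (sg 0%N) (sg 1%N))| + 1248 * W.
Proof.
rewrite -!(cavity_nu_end beta h q g_gauss i).
set b1 := `|C (pi / 2) 2 (fun sg => B (sg 0%N) (sg 1%N))|.
have f10 : C 0 2 f1 = 0.
  have -> : f1 = (fun sg => phi1 (fun l => sg l i) * 1).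
    by apply/funext => sg; rewrite mulr1.
  rewrite (cavity_nu_factor (i := i) (psi := fun=> 1) beta h q g_gauss 2 phi1 (fun _ _ _ => erefl)).
  by rewrite bit_nu_overlap// mul0r.
rewrite -[X in `|X|]subr0 -f10.
(* [80 * W] pays for moving the four-replica average to [th = 0], and [2 * (b1 + 12 * W)] bounds it
   there; [1248 = 12 * (24 + 80)]. *)
rewrite (_ : 24 * b1 + _ = 24 * (2 * (b1 + 12 * W) + 80 * W) / 2); last by field.
have bb0 : 0 <= 2 * (b1 + 12 * W) + 80 * W.
  by apply: addr_ge0; apply: mulr_ge0 => //; apply: addr_ge0; [exact: normr_ge0|exact: mulr_ge0].
apply: (@sincos_derive_dist _ (fun th => C th 2 f1) (fun th => dC th 2 f1)) => //.
  move=> th; apply: is_derive_C; exact: (depends01 (fun s t => x s t - q)).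
move=> th th01.
have := @dC_bound th 2 f1 (2 * (b1 + 12 * W) + 80 * W) bb0 _.
rewrite (_ : 4 * 2 * 3 * _ = 24 * (2 * (b1 + 12 * W) + 80 * W)); last by ring.
apply=> l m l3 m4 lm.
pose f4 (sg : nat -> config N) := f1 sg * path_cov field_u field_v (sg l) (sg m).
have df4 : depends 4 f4.
  by move=> sg sg' e; rewrite /f4 /f1 !e// ltnW.
have /andP[th0 thpi] := th01.
(* [160 = 4 * 4 * 5 * 2]: four replicas, and two second moments of [B] for each product of two
   gaps. *)
have dist : `|C th 4 f4 - C 0 4 f4| <= 160 * W / 2.
  apply: (@sincos_derive_dist _ (fun th => C th 4 f4) (fun th => dC th 4 f4)) => //.
    by move=> y; exact: is_derive_C.
  move=> y y01.
  have := @dC_bound y 4 f4 (2 * W) _ _.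
  rewrite (_ : 4 * 4 * 5 * _ = 160 * W); last by ring.
  apply; first by rewrite mulr_ge0.
  move=> l' m' l5 m6 lm'.
  apply: (@le_trans _ _ (C y 6 (fun sg => B (sg l) (sg m) ^+ 2 + B (sg l') (sg m') ^+ 2))).
    apply: norm_C => sg; rewrite /f4 !normrM !norm_path_cov.
    rewrite -[B (sg l) (sg m) ^+ 2]real_normK ?num_real//.
    rewrite -[B (sg l') (sg m') ^+ 2]real_normK ?num_real//.
    have := norm_xq (sg 0%N) (sg 1%N); rewrite -/(f1 sg).
    move: (normr_ge0 (B (sg l) (sg m))) (normr_ge0 (B (sg l') (sg m'))) (normr_ge0 (f1 sg)).
    set a := `|B _ _|; set b := `|B _ _|; set c := `|f1 _| => a0 b0 c0 c2.
    apply: (@le_trans _ _ (2 * a * b)); first by rewrite ler_wpM2r// ler_wpM2r.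
    have := sqr_ge0 (a - b); nra.
  rewrite /cavity_nu nu_pathD//.
  have l6 : (l < 6)%N by rewrite (leq_trans l3).
  have m6' : (m < 6)%N by rewrite (leq_trans m4).
  have l6' : (l' < 6)%N by rewrite (leq_trans l5).
  have := @B_second_moment y 6 l m y01 l6 m6' lm.
  have := @B_second_moment y 6 l' m' y01 l6' m6 lm'.
  by rewrite mulr2n mulrDl !mul1r /cavity_nu => h1 h2; exact: lerD.
have start : `|C 0 4 f4| <= 2 * (b1 + 12 * W).
  pose phi b := phi1 b * ((-1) ^+ b l * (-1) ^+ b m).
  have -> : f4 = (fun sg => phi (fun l => sg l i) * B (sg l) (sg m)).
    by apply/funext => sg; rewrite /f4 path_covE /phi /f1 /site_prod /spin mulrA.
  rewrite (cavity_nu_factor beta h q g_gauss 4 phi (B_offsite l m)) normrM.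
  have l4 : (l < 4)%N by exact: ltnW.
  have -> : C 0 4 (fun sg => B (sg l) (sg m)) = C 0 2 (fun sg => B (sg 0%N) (sg 1%N)).
    exact: (nu_path_marg2 _ _ _ _ _ _ _ _ (fun s t => B s t)).
  apply: ler_pM => //; apply: bit_nu_bound => // b.
  rewrite /phi normrM [X in _ * X]normrM !normr_sign !mulr1.
  have /andP[q0 q1] := q01.
  rewrite (le_trans (ler_normB _ _))// normrM !normr_sign mulr1 ger0_norm//; lra.
rewrite distrC in dist; apply: le_trans (ler_norm_dist dist) _; apply: lerD => //; lra.
Qed.

Lemma cov_gap_site :
  `|gibbs_nu beta h g 2 (fun sg => B (sg 0%N) (sg 1%N))| <=
  A0 * `|gibbs_nu beta h g 2 (fun sg => D (sg 0%N) (sg 1%N))| +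
  Q * (gibbs_nu beta h g 2 (fun sg => D (sg 0%N) (sg 1%N) ^+ 2) + N%:R^-1).
Proof.
rewrite -!(cavity_nu_end beta h q g_gauss i).
(* The derivative of [beta^2 (p/2) r^(p-1)] at [r = q]. It is at most [A0], the Lipschitz constant
   of the second moment argument, so one smallness condition serves both moments. *)
pose a := beta ^+ 2 * (p%:R / 2 * p.-1%:R * q ^+ p.-2).
have /andP[q0 q1] := q01.
have aA : `|a| <= A0.
  by rewrite /a mulrA -/A0 normrM (ger0_norm A0_ge0) ler_piMr// norm_expr_le1// ger0_norm.
have -> : C (pi / 2) 2 (fun sg => B (sg 0%N) (sg 1%N)) =
    C (pi / 2) 2 (fun sg => B (sg 0%N) (sg 1%N) - a * D (sg 0%N) (sg 1%N)) +
    a * C (pi / 2) 2 (fun sg => D (sg 0%N) (sg 1%N)).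
  by rewrite /cavity_nu nu_pathB// nu_pathZ// subrK.
rewrite (le_trans (ler_normD _ _))// addrC lerD//.
  by rewrite normrM ler_wpM2r.
apply: (@le_trans _ _ (C (pi / 2) 2 (fun sg => Q * (D (sg 0%N) (sg 1%N) ^+ 2 + N%:R^-1)))).
  apply: norm_C => sg; rewrite (le_trans (cov_gap_taylor _ _ p_ge2 q01 _ _))//.
  by rewrite /Q -mulrDr mulrA.
by rewrite /cavity_nu nu_pathZ// nu_pathD// nu_path_cst.
Qed.

End SiteEstimates.

(** * Averaging over the sites *)

Lemma site_mean_le {R : numFieldType} (N : nat) (a : 'I_N -> R) (c : R) : (0 < N)%N ->
  (forall i, a i <= c) -> N%:R^-1 * (\sum_i a i) <= c.
Proof.
move=> N0 ac; rewrite mulrC ler_pdivrMr ?ltr0n// (le_trans (ler_sum _ (fun i _ => ac i)))//.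
by rewrite sumr_const card_ord mulr_natr.
Qed.

Section OverlapMoments.
Context {R : realType} {N p : nat} (beta h q : R).
Hypothesis p_ge2 : (2 <= p)%N.
Hypothesis q01 : 0 <= q <= 1.
Hypothesis hq : overlap_equation p beta h q.
Hypothesis N_gt0 : (0 < N)%N.
Context d (T : measurableType d) (P : probability T R) (g : psites N p -> {RV P >-> R}).
Hypothesis g_gauss : forall t, standard_gaussian (g t).
Hypothesis g_indep : mutually_independent g.

Local Notation E := (gibbs_nu beta h g 2).
Local Notation x i sg := (@site_prod R N (sg 0%N) (sg 1%N) i).
Local Notation D i sg := (cavity_gap q i (sg 0%N) (sg 1%N)).

(** At [pi / 2] the auxiliary field is gone, so any site serves; this one lends [E] the linearity
    and monotonicity of [nu_path]. *)
Let E_cavity f : E f = cavity_nu beta h q g (Ordinal N_gt0) (pi / 2) 2 f.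
Proof. by rewrite cavity_nu_end. Qed.

Let ix := integrable_extended_disorder g_gauss.

Let E_D f f' : E (fun sg => f sg + f' sg) = E f + E f'.
Proof. by rewrite !E_cavity; apply: nu_pathD. Qed.

Let E_Z c f : E (fun sg => c * f sg) = c * E f.
Proof. by rewrite !E_cavity; apply: nu_pathZ. Qed.

Let E_cst c : E (fun=> c) = c.
Proof. by rewrite E_cavity; apply: nu_path_cst. Qed.

Let E_sum (F : 'I_N -> (nat -> config N) -> R) : E (fun sg => \sum_i F i sg) = \sum_i E (F i).
Proof. by under eq_bigr do rewrite E_cavity; rewrite E_cavity; apply: nu_path_sum. Qed.

Let E_le f f' : (forall sg, f sg <= f' sg) -> E f <= E f'.
Proof. by move=> ff'; rewrite !E_cavity; apply: ler_nu_path. Qed.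

Let E_norm f f' : (forall sg, `|f sg| <= f' sg) -> `|E f| <= E f'.
Proof.
move=> ff'; rewrite !E_cavity; apply: (le_trans (ler_norm_nu_path _ ix _ _ _ _ _ _ _)).
exact: ler_nu_path.
Qed.

Definition overlap_gap (s t : config N) : R := N%:R^-1 * (\sum_j site_prod s t j) - q.

Local Notation o sg := (overlap_gap (sg 0%N) (sg 1%N)).

Let N0 : 0 < N%:R :> R. Proof. by rewrite ltr0n. Qed.
Let r := N%:R^-1 : R.
Let r0 : 0 < r. Proof. by rewrite /r invr_gt0. Qed.
Let r1 : r <= 1. Proof. by rewrite /r invf_le1// ler1n. Qed.

Let oE i sg : o sg = D i sg + r * x i sg.
Proof. by rewrite /overlap_gap /cavity_gap (bigD1 i)//= mulrDr -/r; ring. Qed.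

Let oE_mean sg : o sg = r * \sum_i (x i sg - q).
Proof.
rewrite sumrB mulrBr sumr_const card_ord -[q *+ N]mulr_natr [q * _]mulrC mulrA.
by rewrite /r mulVf ?mul1r// gt_eqF.
Qed.

Let norm_xq i sg : `|x i sg - q| <= 2.
Proof.
have /andP[q0 q1] := q01.
by rewrite (le_trans (ler_normB _ _))// norm_site_prod ger0_norm//; lra.
Qed.

Let norm_o sg : `|o sg| <= 2.
Proof.
rewrite oE_mean normrM (ger0_norm (ltW r0)).
apply: le_trans (site_mean_le N_gt0 (fun i => norm_xq i sg)).
by rewrite ler_pM2l// ler_norm_sum.
Qed.

Let A0 := beta ^+ 2 * (p%:R / 2 * p.-1%:R).
Let Q := beta ^+ 2 * p%:R ^+ 3.
Let E0 := expR (12 * (beta ^+ 2 * p%:R)).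
Let V := E (fun sg => o sg ^+ 2).
Let m := E (fun sg => o sg).

(** Expand the square of [D = o - r * x]: with [|o| <= 2] and [|x| = 1] the cross term costs at most
    [4 * r], and [r ^+ 2 <= r]. *)
Let cavity_second_moment i : E (fun sg => D i sg ^+ 2) <= V + 5 * r.
Proof.
rewrite -[5 * r]E_cst -E_D; apply: E_le => sg.
rewrite (_ : D i sg = o sg - r * x i sg); last by rewrite (oE i) addrK.
have := norm_o sg; rewrite ler_norml => /andP[y1 y2].
have : `|x i sg| <= 1 by rewrite norm_site_prod.
rewrite ler_norml => /andP[x1 x2].
have ox : - (2 * (o sg * x i sg)) <= 4.
  move: (o sg) (x i sg) y1 y2 x1 x2 => a b; nra.
have x2' : x i sg ^+ 2 = 1 by rewrite expr2 site_prod_sqr.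
rewrite sqrrB exprMn x2' mulr1.
have rr : r ^+ 2 <= r by rewrite expr2 ler_piMl// ltW.
have := ler_wpM2l (ltW r0) ox; rewrite -mulr_natr; lra.
Qed.

Let cavity_mean i : `|E (fun sg => D i sg)| <= `|m| + r.
Proof.
rewrite (_ : E (fun sg => D i sg) = m + - 1 * E (fun sg => r * x i sg)).
  rewrite (le_trans (ler_normD _ _))// lerD2l mulN1r normrN -[leRHS]E_cst.
  by apply: E_norm => sg; rewrite normrM norm_site_prod mulr1 ger0_norm// ltW.
by rewrite /m -E_Z -E_D; congr gibbs_nu; apply/funext => sg; rewrite (oE i); ring.
Qed.

Lemma second_moment_overlap : 24 * A0 * E0 <= 3 / 4 ->
  E (fun sg => o sg ^+ 2) <= (23 + 192 * Q) * N%:R^-1.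
Proof.
move=> kappa; rewrite -/V -/r.
have kappa0 : 0 <= 24 * A0 * E0.
  by rewrite /A0 mulr_ge0 ?expR_ge0// mulr_ge0// mulr_ge0 ?sqr_ge0// mulr_ge0// divr_ge0.
have V0 : 0 <= V by rewrite -[0]E_cst; apply: E_le => sg; exact: sqr_ge0.
have site i : E (fun sg => (x i sg - q) * o sg) <= 3 / 4 * (V + 5 * r) + 48 * (Q * r) + 2 * r.
  rewrite (_ : E _ = E (fun sg => (x i sg - q) * D i sg) +
    E (fun sg => r * ((x i sg - q) * x i sg))).
    apply: lerD.
      apply: le_trans (le_trans (ler_norm _) (second_moment_site p_ge2 q01 hq g_gauss g_indep i)) _.
      apply: lerD => //; apply: ler_pM => //.
      by rewrite -[0]E_cst; apply: E_le => sg; exact: sqr_ge0.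
    rewrite mulrC -[leRHS]E_cst; apply: E_le => sg; rewrite ler_pM2l//.
    rewrite (le_trans (ler_norm _))// normrM norm_site_prod mulr1; exact: norm_xq.
  by rewrite -E_D; congr gibbs_nu; apply/funext => sg; rewrite (oE i); ring.
have VE : V = r * \sum_i E (fun sg => (x i sg - q) * o sg).
  rewrite -E_sum -E_Z; congr gibbs_nu; apply/funext => sg.
  by rewrite -mulr_suml mulrA -oE_mean expr2.
(* Absorbing [3 / 4 * V] on the left multiplies the rest by [4]: [23 = 4 * (15 / 4 + 2)] and
   [192 = 4 * 48]. *)
have : V <= 3 / 4 * (V + 5 * r) + 48 * (Q * r) + 2 * r.
  by rewrite {1}VE; exact: site_mean_le.
have := r0; lra.
Qed.

Lemma first_moment_overlap : 24 * A0 <= 3 / 4 -> 24 * A0 * E0 <= 3 / 4 ->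
  `|E (fun sg => o sg)| <=
  4 * (3 / 4 + 24 * Q * (29 + 192 * Q) + 2496 * Q ^+ 2 * (E0 * (28 + 192 * Q) + 1)) * N%:R^-1.
Proof.
move=> A034 kappa; rewrite -/m -/r.
have VK := second_moment_overlap kappa; rewrite -/V -/r in VK.
have A00 : 0 <= A0 by rewrite /A0 mulr_ge0 ?sqr_ge0// mulr_ge0// divr_ge0.
have Q0 : 0 <= Q by rewrite /Q mulr_ge0 ?sqr_ge0 ?exprn_ge0.
have E00 : 0 <= E0 := expR_ge0 _.
(* [28 = 23 + 5] comes from leaving out a site in the second moment, [29] includes one more [1 / N]
   from [cov_gap_site], and [2496 = 2 * 1248] includes the [2] of [W]. *)
set K := 24 * Q * (29 + 192 * Q) + 2496 * Q ^+ 2 * (E0 * (28 + 192 * Q) + 1).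
have site i : `|E (fun sg => x i sg - q)| <= 3 / 4 * (`|m| + r) + K * r.
  apply: le_trans (first_moment_site p_ge2 q01 hq g_gauss g_indep i) _.
  rewrite cavity_nu_end//.
  have cov := cov_gap_site beta h p_ge2 q01 g_gauss i.
  have := cavity_mean i; have := cavity_second_moment i.
  have M0 : 0 <= E (fun sg => D i sg ^+ 2).
    by rewrite -[0]E_cst; apply: E_le => sg; exact: sqr_ge0.
  move: cov M0; rewrite -/A0 -/Q -/E0 -/r.
  set b := `|E (fun sg => cov_gap _ _ _ _ _)|; set c := `|E _|; set M := E _ => cov M0 MV cm.
  have M1 : M <= (28 + 192 * Q) * r by move: MV VK; lra.
  have h1 : 24 * b <= 24 * A0 * c + 24 * Q * (M + r) by move: cov; lra.
  have h2 : 24 * A0 * c <= 3 / 4 * (`|m| + r).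
    by apply: ler_pM => //; [exact: mulr_ge0|exact: normr_ge0].
  have h3 : 24 * Q * (M + r) <= 24 * Q * ((29 + 192 * Q) * r).
    by apply: ler_wpM2l; [exact: mulr_ge0|move: M1; lra].
  have h4 : 2496 * Q ^+ 2 * (E0 * M + r) <=
      2496 * Q ^+ 2 * (E0 * ((28 + 192 * Q) * r) + r).
    apply: ler_wpM2l; first by apply: mulr_ge0; [exact: ler0n|exact: sqr_ge0].
    by rewrite lerD2r; exact: ler_wpM2l.
  rewrite (_ : 1248 * _ = 2496 * Q ^+ 2 * (E0 * M + r)); last by ring.
  rewrite /K (_ : (_ + _) * r = 24 * Q * ((29 + 192 * Q) * r) +
    2496 * Q ^+ 2 * (E0 * ((28 + 192 * Q) * r) + r)); last by ring.
  by move: h1 h2 h3 h4; lra.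
have mE : m = r * \sum_i E (fun sg => x i sg - q).
  by rewrite -E_sum -E_Z; congr gibbs_nu; apply/funext => sg; rewrite oE_mean.
have : `|m| <= 3 / 4 * (`|m| + r) + K * r.
  rewrite {1}mE normrM (ger0_norm (ltW r0)).
  apply: le_trans (site_mean_le N_gt0 site).
  by rewrite ler_pM2l// ler_norm_sum.
rewrite -[3 / 4 + _ + _]addrA -/K; lra.
Qed.

(** [nu] is an extended real; it is finite because the Gibbs averages of a fixed function are
    bounded. *)
Lemma nu_overlap_gap :
  nu beta h g (fun s : 2.-tuple (config N) => overlap ord0 ord_max s - q) =
  (E (fun sg => o sg))%:E.
Proof.
rewrite /nu unlock /gibbs_nu /Rintegral fineK; last first.
  apply: integrable_fin_num => //.
  have [C CP] := avg_le1_bounded (@config0 N) 2 (fun sg => o sg).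
  apply: (@integrable_bounded _ _ _ P _ C); last first.
    by move=> w; apply: CP; [exact: (gibbs_ge0 config0)|exact: (gibbs_sum1 config0)].
  apply: measurable_avg => s; apply: measurable_gibbs => // {}s.
  rewrite /hamiltonian; under eq_fun do rewrite opprK.
  apply: measurable_funD => //; apply: measurable_funM => //.
  by apply: measurable_sum_fin => t; exact: measurable_funM.
apply: eq_integral => w _; congr EFin.
exact: (gibbs_average2 beta h (g^~ w) overlap_gap).
Qed.

End OverlapMoments.

(** * The condition on the temperature and the conclusion *)

Section Temperature.
Context {R : realType} (p : nat) (beta_p beta : R).
Hypothesis beta_p_gt0 : 0 < beta_p.
Hypothesis beta_pE :
  8 * p%:R ^+ 2 * beta_p ^+ 2 * expR (16 * beta_p ^+ 2 * p%:R) = 2^-1.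
Hypothesis beta_gt0 : 0 < beta.
Hypothesis beta_lt : beta < beta_p.

(** By [p * p.-1 <= p ^+ 2] and [12 <= 16] in the exponent, the left side is at most [12 / 8] times
    that of the equation for [beta_p], that is [3 / 2 * 1 / 2]. *)
Lemma contraction_exp :
  24 * (beta ^+ 2 * (p%:R / 2 * p.-1%:R)) * expR (12 * (beta ^+ 2 * p%:R)) <= 3 / 4.
Proof.
have b2 : beta ^+ 2 <= beta_p ^+ 2 by rewrite lerXn2r// ?nnegrE ?ltW.
have b0 := ltW beta_gt0; have bp0 := ltW beta_p_gt0.
have pp : p.-1%:R <= p%:R :> R by rewrite ler_nat leq_pred.
have e : expR (12 * (beta ^+ 2 * p%:R)) <= expR (16 * beta_p ^+ 2 * p%:R).
  rewrite ler_expR -mulrA; apply: ler_pM; rewrite ?mulr_ge0 ?sqr_ge0 ?ler_nat//.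
  by rewrite ler_wpM2r.
rewrite (_ : 3 / 4 = 12 * p%:R ^+ 2 * beta_p ^+ 2 * expR (16 * beta_p ^+ 2 * p%:R)).
  rewrite (_ : 24 * _ = 12 * (p%:R * p.-1%:R) * beta ^+ 2); last by field.
  apply: ler_pM; rewrite ?expR_ge0 ?mulr_ge0 ?sqr_ge0//.
  apply: ler_pM; rewrite ?mulr_ge0 ?sqr_ge0//.
  by rewrite ler_pM2l// expr2 ler_wpM2l.
by move: beta_pE; set e1 := expR _; lra.
Qed.

Lemma contraction : 24 * (beta ^+ 2 * (p%:R / 2 * p.-1%:R)) <= 3 / 4.
Proof.
apply: le_trans contraction_exp; rewrite ler_peMr//.
  by rewrite mulr_ge0// mulr_ge0 ?sqr_ge0// mulr_ge0// divr_ge0.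
by rewrite -expR0 ler_expR mulr_ge0// mulr_ge0// sqr_ge0.
Qed.

End Temperature.

Theorem theorem3p9 (R : realType) (p : nat) (beta_p beta h q : R)
    (hp : (2 <= p)%N)
    (hh : 0 < h)
    (hbeta_p0 : 0 < beta_p)
    (hbeta_p : 8 * p%:R ^+ 2 * beta_p ^+ 2 * expR (16 * beta_p ^+ 2 * p%:R)
               = 2^-1)
    (hbeta0 : 0 < beta)
    (hbeta : beta < beta_p)
    (hq0 : 0 <= q)
    (hq1 : q <= 1)
    (hq : overlap_equation p beta h q) :
  exists K : R, forall (N : nat), (p <= N)%N ->
    forall (d : measure_display) (T : measurableType d) (P : probability T R)
      (g : psites N p -> {RV P >-> R}),
      (forall t, standard_gaussian (g t)) ->
      mutually_independent g ->
      (`| nu beta h g (fun s : 2.-tuple (config N) =>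
            (overlap ord0 ord_max s - q)%R) | <= (K / N%:R)%:E)%E.
Proof.
(* The witness is the constant of [first_moment_overlap]; it is built from [p] and [beta] alone, so
   it can be chosen before [N] and the disorder. *)
eexists => N pN d T P g g_gauss g_indep.
have N_gt0 : (0 < N)%N by exact: leq_trans (ltnW hp) pN.
rewrite nu_overlap_gap abse_EFin lee_fin.
apply: first_moment_overlap => //; first exact/andP.
- exact: contraction hbeta_p _ _.
- exact: contraction_exp hbeta_p _ _.
Qed.
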